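(* Let $\mathfrak p=(p_d)_{d\ge1}$ be a sequence of polynomials, $p_d\in\mathcal P_d(\mathbb R)$, with limiting distribution $\mu\in\mathcal M(\mathbb R)$. Then the following two conditions are equivalent. (1) The sequence $\mathfrak p$ has infinitesimal moments of all orders, i.e. there is a sequence $(m_n'(\mathfrak p))_{n\ge1}$ of real numbers not depending on $d$ such that, as $d\to\infty$, $$m_n(p_d)=m_n(\mu)+\frac1d\,m_n'(\mathfrak p)+o(1/d)\qquad\text{for every } n\ge1.$$ (2) There is a sequence $(\widehat r_n(\mathfrak p))_{n\ge1}$ of real numbers not depending on $d$ such that, as $d\to\infty$ (with $d\ge n$), $$\kappa_n(p_d)=r_n(\mu)+\frac1d\,\widehat r_n(\mathfrak p)+o(1/d)\qquad\text{for every } n\ge1.$$ Moreover, if either of these conditions holds, then the sequences $(m_n'(\mathfrak p))_{n\ge1}$ and $(\widehat r_n(\mathfrak p))_{n\ge1}$ determine each other through the relation $$m_n'(\mathfrak p)=\sum_{\pi\in NC(n)}\sum_{V\in\pi}\widehat r_{|V|}(\mathfrak p)\cdot r_{\pi\setminus V}(\mu)\;-\;\frac n2\sum_{\substack{t+s=n\\ \sigma\in S_{NC}(t,s)}}\frac{r_\sigma(\mu)}{ts}\qquad\text{for every } n\ge1.$$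
   Context: $\mathcal M(\mathbb R)$ is the set of probability distributions on $\mathbb R$; $\mathcal P_d(\mathbb R)$ is the set of monic real polynomials of degree $d$ all of whose roots are real. For $p_d\in\mathcal P_d(\mathbb R)$ with roots $\lambda_1,\dots,\lambda_d$ (with multiplicity), $m_n(p_d)=\frac1d\sum_{k=1}^d\lambda_k^n$. Write $p_d(x)=\sum_{k=0}^d x^{d-k}(-1)^k\binom dk\mathsf e_k(p_d)$. The finite-free cumulants of $p_d$ are, for $1\le n\le d$, $$\kappa_n(p_d)=\frac{(-d)^{n-1}}{(n-1)!}\sum_{\pi\in P(n)}(-1)^{|\pi|-1}(|\pi|-1)!\prod_{V\in\pi}\mathsf e_{|V|}(p_d),$$ where $P(n)$ is the set of partitions of $[n]=\{1,\dots,n\}$ and $|\pi|$ is the number of blocks. The sequence $\mathfrak p$ has limiting distribution $\mu$ ($\mu$ having finite moments $m_n(\mu)=\int t^n\,d\mu(t)$ of all orders) if $m_n(p_d)\to m_n(\mu)$ as $d\to\infty$ for every $n\ge0$. $NC(n)$ is the set of non-crossing partitions of $[n]$. For a numerical sequence $(u_n)_{n\ge1}$, $u_\pi=\prod_{V\in\pi}u_{|V|}$ for a partition $\pi$, $u_{\pi\setminus V}=\prod_{W\in\pi,\,W\ne V}u_{|W|}$ for $V\in\pi$, and $u_\sigma=\prod_{c}u_{|c|}$ over the cycles $c$ (fixed points included) of a permutation $\sigma$, with $|c|$ the cycle length. The free cumulants $(r_n(\mu))_{n\ge1}$ are defined recursively by $m_n(\mu)=\sum_{\pi\in NC(n)}r_\pi(\mu)$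 for $n\ge1$. For integers $t,s\ge1$ let $\gamma_{t,s}=(1,\dots,t)(t+1,\dots,t+s)\in S_{t+s}$. $S_{NC}(t,s)$ is the set of $\sigma\in S_{t+s}$ such that the subgroup generated by $\sigma$ and $\gamma_{t,s}$ acts transitively on $[t+s]$ and $|\sigma|+|\sigma^{-1}\gamma_{t,s}|=t+s$, where $|\cdot|$ counts cycles including fixed points. Sums over $t+s=n$ run over ordered pairs of integers $t,s\ge1$ (empty for $n=1$). *)

(* Defs.v *)
From HB Require Import structures.
From mathcomp Require Import all_boot all_order all_algebra all_fingroup.
From mathcomp Require Import complex.

Set Implicit Arguments.
Unset Strict Implicit.
Unset Printing Implicit Defensive.

Import Order.TTheory GRing.Theory Num.Theory.

Local Open Scope ring_scope.

Section Partitions.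
Variable n : nat.

Definition set_partitions : {set {set {set 'I_n}}} :=
  [set P : {set {set 'I_n}} | partition P [set: 'I_n]].

Definition crossing (V W : {set 'I_n}) : bool :=
  [exists a : 'I_n, exists b : 'I_n, exists c : 'I_n, exists e : 'I_n,
    [&& (a < b)%N, (b < c)%N, (c < e)%N,
        a \in V, c \in V, b \in W & e \in W]].

Definition NC : {set {set {set 'I_n}}} :=
  [set P in set_partitions |
     [forall V in P, forall W in P, (V != W) ==> ~~ crossing V W]].

End Partitions.

Section FreeCumulants.
Variable R : comPzRingType.

Definition mult_ext (u : nat -> R) n (P : {set {set 'I_n}}) : R :=
  \prod_(V in P) u #|V|.

(* [free_cumulants_upto m n] lists r_1, ..., r_n. The coarsest partition
   contributes r_n to the moment-cumulant relation
   m_n = \sum_(P in NC n) r_P and the other non-crossing partitions only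
   involve r_1, ..., r_(n-1), so r_n is obtained by solving for it. *)
Fixpoint free_cumulants_upto (m : nat -> R) (n : nat) : seq R :=
  if n is k.+1 then
    let s := free_cumulants_upto m k in
    rcons s (m k.+1 - \sum_(P in NC k.+1 | P != [set [set: 'I_k.+1]])
                        mult_ext (fun j => s`_j.-1) P)
  else [::].

Definition free_cumulant_seq (m : nat -> R) (n : nat) : R :=
  (free_cumulants_upto m n)`_n.-1.

Lemma size_free_cumulants_upto m n : size (free_cumulants_upto m n) = n.
Proof. by elim: n => //= n IHn; rewrite size_rcons IHn. Qed.

Lemma nth_free_cumulants_upto m n j : (0 < j <= n)%N ->
  (free_cumulants_upto m n)`_j.-1 = free_cumulant_seq m j.
Proof.
elim: n => [|n IHn]; first by case: j.
case/andP=> j0; rewrite leq_eqVlt => /orP[/eqP -> //|]; rewrite ltnS => jn.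
rewrite /= nth_rcons size_free_cumulants_upto prednK// jn.
by rewrite IHn// j0 jn.
Qed.

Lemma top_NC n : [set [set: 'I_n.+1]] \in NC n.+1.
Proof.
rewrite !inE; apply/andP; split.
  apply/and3P; split.
  - by rewrite /cover big_set1.
  - exact: trivIset1.
  - by rewrite inE eq_sym; apply/set0Pn; exists ord0; rewrite inE.
by apply/forall_inP => V /set1P ->; apply/forall_inP => W /set1P ->;
  rewrite eqxx.
Qed.

Lemma free_cumulant_seqP (m : nat -> R) n : (0 < n)%N ->
  m n = \sum_(P in NC n) mult_ext (free_cumulant_seq m) P.
Proof.
case: n => // n _; rewrite (bigD1 _ (top_NC n)) /=.
rewrite {1}/mult_ext big_set1 cardsT card_ord.
rewrite {1}/free_cumulant_seq /= nth_rcons size_free_cumulants_upto ltnn eqxx.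
rewrite -[LHS](subrK (\sum_(P in NC n.+1 | P != [set [set: 'I_n.+1]])
  mult_ext (free_cumulant_seq m) P)); congr (_ - _ + _).
apply: eq_bigr => P /andP[]; rewrite !inE => /andP[partP _] Ptop.
apply: eq_bigr => V VP; rewrite nth_free_cumulants_upto //.
case/and3P: (partP) => /eqP coverP trivP P0.
have V0 : V != set0 by apply: contraNneq P0 => <-.
rewrite card_gt0 V0 /= -ltnS -[X in (_ < X)%N](card_ord n.+1) -cardsT.
apply: proper_card; rewrite properT; apply: contraNneq Ptop => VT.
apply/eqP/setP => W; rewrite in_set1; apply/idP/eqP => [WP|->]; last by rewrite -VT.
rewrite -VT; apply/eqP; apply/negPn/negP => WV.
have /set0Pn[x xW] : W != set0 by apply: contraNneq P0 => <-.
have := trivIsetP trivP W V WP VP WV.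
by rewrite -setI_eq0 => /eqP/setP/(_ x); rewrite VT !inE xW.
Qed.

End FreeCumulants.

Section AnnularPermutations.
Local Open Scope group_scope.
Variables t s : nat.

(* On 'I_(t + s) (0-based), the cycle (0, ..., t-1)(t, ..., t+s-1). *)
Definition gamma_fun (i : 'I_(t + s)) : 'I_(t + s) :=
  match split i with
  | inl j => lshift s (ordS j)
  | inr k => rshift t (ordS k)
  end.

Lemma gamma_fun_inj : injective gamma_fun.
Proof.
move=> i j; rewrite /gamma_fun; case: (splitP i) => a ai; case: (splitP j) => b bj.
- by move/lshift_inj/ordS_inj => ab; apply: val_inj; rewrite /= ai bj ab.
- by move/eqP; rewrite eq_lrshift.
- by move/eqP; rewrite eq_rlshift.
- by move/rshift_inj/ordS_inj => ab; apply: val_inj; rewrite /= ai bj ab.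
Qed.

Definition gamma : 'S_(t + s) := perm gamma_fun_inj.

(* The product of permutations composes from left to right; sigma^-1 * gamma
   has the same number of cycles for either convention. *)
Definition S_NC : {set 'S_(t + s)} :=
  [set sigma : 'S_(t + s) |
     [transitive <<[set sigma; gamma]>>, on [set: 'I_(t + s)] | 'P]
     && (#|porbits sigma| + #|porbits (sigma^-1 * gamma)| == t + s)%N].

End AnnularPermutations.

Definition mult_ext_perm (R : comPzRingType) (u : nat -> R) n (sigma : 'S_n) : R :=
  \prod_(c in porbits sigma) u #|c|.

(* Loaded only now, because its set notations shadow those of [finset]. *)
From mathcomp Require Import all_classical all_reals all_analysis.

Import numFieldNormedType.Exports.

Local Open Scope classical_set_scope.

Section FiniteFree.
Variable R : realType.

Definition real_rooted_poly (d : nat) (p : {poly R}) : Prop :=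
  [/\ p \is monic, size p = d.+1 &
      forall z : complex R, root (map_poly (real_complex R) p) z ->
        exists x : R, z = real_complex R x].

Definition poly_moment (d : nat) (p : {poly R}) (n : nat) : R :=
  (d%:R)^-1 * \sum_(x \in [set x : R | root p x]) (mup x p)%:R * x ^+ n.

(* Read off from p = \sum_(k <= d) (-1)^k 'C(d, k) e_k 'X^(d - k), for k <= d. *)
Definition poly_e (d : nat) (p : {poly R}) (k : nat) : R :=
  (-1) ^+ k * p`_(d - k) / ('C(d, k))%:R.

Definition finite_free_cumulant (d : nat) (p : {poly R}) (n : nat) : R :=
  (- d%:R) ^+ n.-1 / (n.-1)`!%:R *
  \sum_(P in set_partitions n)
     (-1) ^+ #|P|.-1 * (#|P|.-1)`!%:R * mult_ext (poly_e d p) P.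

Definition finite_moments (mu : probability (measurableTypeR R) R) : Prop :=
  forall n : nat, mu.-integrable [set: R] (fun x : R => (x ^+ n)%:E).

Definition moment (mu : probability (measurableTypeR R) R) (n : nat) : R :=
  Rintegral mu [set: R] (fun x : R => x ^+ n).

Definition free_cumulant (mu : probability (measurableTypeR R) R) : nat -> R :=
  free_cumulant_seq (moment mu).

Definition limiting_distribution (p : nat -> {poly R})
    (mu : probability (measurableTypeR R) R) : Prop :=
  finite_moments mu /\
  forall n : nat, poly_moment d (p d) n @[d --> \oo] --> moment mu n.

Definition infinitesimal_moments (p : nat -> {poly R})
    (mu : probability (measurableTypeR R) R) (m' : nat -> R) : Prop :=
  forall n : nat, (0 < n)%N ->
    (fun d : nat => poly_moment d (p d) n : R^o)
    = (fun d : nat => moment mu n + d%:R^-1 * m' n : R^o)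
      +o_\oo (fun d : nat => d%:R^-1 : R^o).

Definition infinitesimal_cumulants (p : nat -> {poly R})
    (mu : probability (measurableTypeR R) R) (r' : nat -> R) : Prop :=
  forall n : nat, (0 < n)%N ->
    (fun d : nat => finite_free_cumulant d (p d) n : R^o)
    = (fun d : nat => free_cumulant mu n + d%:R^-1 * r' n : R^o)
      +o_\oo (fun d : nat => d%:R^-1 : R^o).

Definition infinitesimal_relation
    (mu : probability (measurableTypeR R) R) (m' r' : nat -> R) : Prop :=
  forall n : nat, (0 < n)%N ->
    m' n =
      \sum_(P in NC n) \sum_(V in P)
         r' #|V| * mult_ext (free_cumulant mu) (P :\ V)%SET
      - n%:R / 2%:R *
        \sum_(1 <= t < n) \sum_(sigma in S_NC t (n - t))
           mult_ext_perm (free_cumulant mu) sigma / (t * (n - t))%:R.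

End FiniteFree.

(* Main.v *)
Require Import Defs.
From mathcomp Require Import all_boot all_order all_algebra all_fingroup.
From mathcomp Require Import complex zify ring.

(** Write [kappa_j] for the finite free cumulants of a polynomial of degree [d],
    [m_n] for its moments, [|s|] for the number of cycles of a permutation [s]
    and [kappa_s] for the product of the [kappa_|c|] over the cycles [c] of [s].
    Everything rests on an exact formula ([genus_expansion]): for [1 <= n <= d],

      [(n - 1)! m_n = \sum_(s, t) (-d) ^ (|s| + |t| - n - 1) kappa_s],

    where [(s, t)] ranges over the pairs of permutations of [n] points that
    generate a transitive group.  If the pairs are unrestricted, the sum factors
    into two sums over one permutation each: the first is the normalized
    coefficient [e_n], because [kappa] inverts the moment-cumulant relation over
    all set partitions ([perm_sum_cumulant]), the second is a falling factorial
    of [d] ([perm_sum_const]), and their product is the coefficient of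
    [X ^ (d - n)] up to a scalar.  Splitting off the orbit of a point
    ([transitive_sum_rec]) expresses the sums over all pairs through the sums
    over transitive pairs by the same recursion that Newton's identities provide
    between coefficients and power sums, whence the formula.

    A transitive pair satisfies [|s| + |t| + |s t| <= n + 2]
    ([genus_bound_transitive]), so only non-positive powers of [d] occur.
    Exponent [0] forces [s t] to be an [n]-cycle.  All [n]-cycles are conjugate,
    there are [(n - 1)!] of them, and for one [n]-cycle the admissible [s] are
    the noncrossing partitions ([sum_genus0_NC], Biane's bijection).  Exponent
    [-1] forces [s t] to have two cycles, by the bound and by parity; then
    [s t] is conjugate to some [gamma t r], and counting the conjugators gives
    the annular term with its factor [n / 2] ([pair_sum_annular]).  Thus

      [m_n = \sum_(P in NC n) kappa_P - annular_sum n kappa / d + O(1 / d ^ 2)],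

    a polynomial identity in the cumulants and [1 / d], through which expansions
    to order [1 / d] pass ([jet_genus_moment]).  In the opposite direction,
    [m_n] depends affinely on [kappa_n], with a coefficient that tends to [1],
    and the rest only involves earlier cumulants: the expansions of the cumulants
    follow by induction, and so does the uniqueness of their [1 / d] terms. *)

Set Implicit Arguments.
Unset Strict Implicit.
Unset Printing Implicit Defensive.

Import Order.TTheory GRing.Theory Num.Theory.

(** * Stable sets and joint orbits of two permutations *)

Section StableSets.
Variable T : finType.
Implicit Types (S A : {set T}) (s t : {perm T}) (x y : T).

(** Stated as an equivalence, so that stable sets are closed under complement and
    intersection without any appeal to finiteness. *)
Definition stable S s := [forall x, (s x \in S) == (x \in S)].

Lemma stableP S s : reflect (forall x, (s x \in S) = (x \in S)) (stable S s).
Proof. by apply: (iffP forallP) => h x; apply/eqP; rewrite h. Qed.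

Lemma stableX S s i x : stable S s -> ((s ^+ i)%g x \in S) = (x \in S).
Proof.
move/stableP => h; rewrite permX; elim: i => //= i <-; exact: h.
Qed.

Lemma porbit_sub S s x : stable S s -> x \in S -> porbit s x \subset S.
Proof. by move=> h xS; apply/subsetP => y /porbitP[i ->]; rewrite stableX. Qed.

Lemma stable_porbit s x : stable (porbit s x) s.
Proof.
by apply/stableP => y; rewrite -!eq_porbit_mem -(porbit_perm s 1 y) expg1.
Qed.

Lemma perm_on_stable S s : perm_on S s -> stable S s.
Proof. by move=> h; apply/stableP => x; rewrite perm_closed. Qed.

Lemma stableD S A s : stable S s -> stable A s -> stable (S :\: A) s.
Proof.
by move=> /stableP h /stableP k; apply/stableP => x; rewrite !inE h k.
Qed.

Lemma stableM S s t : stable S s -> stable S t -> stable S (s * t)%g.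
Proof. by move=> /stableP h /stableP k; apply/stableP => x; rewrite permM k h. Qed.

Lemma stableV S s : stable S s -> stable S s^-1%g.
Proof. by move=> /stableP h; apply/stableP => x; rewrite -h permKV. Qed.

Lemma eq_stable S A s t : A \subset S -> {in S, s =1 t} ->
  stable S s -> stable S t -> stable A s -> stable A t.
Proof.
move=> /subsetP AS st /stableP Ss /stableP St /stableP As; apply/stableP => x.
have [xS|xS] := boolP (x \in S); first by rewrite -st ?As.
rewrite (contraNF (AS x) xS); apply: contraNF xS => /AS; by rewrite St.
Qed.

Lemma eq_porbit S s t x : {in S, s =1 t} -> stable S s -> x \in S ->
  porbit s x = porbit t x.
Proof.
move=> st Ss xS.
have e i : (s ^+ i)%g x = (t ^+ i)%g x.
  elim: i => [|i ih]; first by rewrite !expg0 !perm1.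
  by rewrite !expgSr !permM -ih st // stableX.
by apply/setP => y; apply/porbitP/porbitP => -[i ->]; exists i.
Qed.

(** The orbit of [x] under the group generated by [s] and [t], as the least set
    containing [x] that is stable under both. *)
Definition joint_orbit s t x :=
  \bigcap_(A : {set T} | [&& x \in A, stable A s & stable A t]) A.

Lemma joint_orbit_id s t x : x \in joint_orbit s t x.
Proof. by apply/bigcapP => A /and3P[]. Qed.

Lemma joint_orbit_min A s t x : x \in A -> stable A s -> stable A t ->
  joint_orbit s t x \subset A.
Proof. by move=> xA As At; apply: bigcap_inf; rewrite xA As At. Qed.

Lemma joint_orbit_stablel s t x : stable (joint_orbit s t x) s.
Proof.
apply/stableP => y; apply/bigcapP/bigcapP => h A hA; have := h A hA;
  by case/and3P: hA => _ /stableP -> _.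
Qed.

Lemma joint_orbit_stabler s t x : stable (joint_orbit s t x) t.
Proof.
apply/stableP => y; apply/bigcapP/bigcapP => h A hA; have := h A hA;
  by case/and3P: hA => _ _ /stableP ->.
Qed.

(** The joint orbit of [x] only depends on the two permutations inside a set that
    contains [x] and is stable under both. *)
Lemma eq_joint_orbit S s t s' t' x : x \in S -> {in S, s =1 s'} -> {in S, t =1 t'} ->
  stable S s -> stable S t -> stable S s' -> stable S t' ->
  joint_orbit s t x = joint_orbit s' t' x.
Proof.
have sub (a b a' b' : {perm T}) : x \in S -> {in S, a =1 a'} -> {in S, b =1 b'} ->
  stable S a -> stable S b -> stable S a' -> stable S b' ->
  joint_orbit a' b' x \subset joint_orbit a b x.
  move=> xS ea eb Sa Sb Sa' Sb'; have oS := joint_orbit_min xS Sa Sb.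
  apply: joint_orbit_min; first exact: joint_orbit_id.
  - exact: eq_stable oS ea _ _ (joint_orbit_stablel a b x).
  - exact: eq_stable oS eb _ _ (joint_orbit_stabler a b x).
move=> xS es et *; apply/eqP; rewrite eqEsubset !sub //.
  by move=> y yS; rewrite es.
by move=> y yS; rewrite et.
Qed.

Lemma astabs_stable S s : stable S s -> s \in ('N(S | 'P))%g.
Proof.
by move/stableP=> h; apply/astabsP => x; rewrite /= apermE h.
Qed.

End StableSets.

(** * The genus bound for pairs of permutations *)

Section Genus.
Local Open Scope group_scope.
Variable T : finType.
Implicit Types (s t : {perm T}) (x y z : T).

Lemma porbits_mul_tpermr s x y :
  (#|porbits (s * tperm x y)| + (x \notin porbit s y).*2 = #|porbits s| + (x != y))%N.
Proof. by rewrite -porbitsV invMg tpermV -porbitV porbits_mul_tperm porbitsV. Qed.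

Lemma porbits_tperm_split s x y : x != y -> x \in porbit s y ->
  #|porbits (s * tperm x y)| = #|porbits s|.+1.
Proof.
by move=> xy xsy; have := porbits_mul_tpermr s x y; rewrite xsy xy addn0 addn1.
Qed.

Lemma porbits1 : #|porbits (1 : {perm T})| = #|T|.
Proof.
rewrite card_imset ?cardsT // => x y /setP/(_ x).
by rewrite porbit_id => /esym/porbitP[i ->]; rewrite expg1n perm1.
Qed.

Lemma porbit_conj s t x : porbit (s ^ t) (t x) = t @: porbit s x.
Proof.
apply/setP => y; apply/porbitP/imsetP => [[i ->]|[z /porbitP[i ->] ->]].
  by exists ((s ^+ i) x); rewrite ?mem_porbit // -conjXg permJ.
by exists i; rewrite -conjXg permJ.
Qed.

Lemma porbits_conjE s t : porbits (s ^ t) = [set t @: (C : {set T}) | C in porbits s].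
Proof.
apply/setP => c; apply/imsetP/imsetP => [[x _ ->]|[C /imsetP[x _ ->] ->]].
  exists (porbit s (t^-1 x)); last by rewrite -porbit_conj permKV.
  by apply: imset_f.
by exists (t x); rewrite ?porbit_conj.
Qed.

Lemma porbits_conj s t : #|porbits (s ^ t)| = #|porbits s|.
Proof. by rewrite porbits_conjE card_imset //; apply: imset_inj; exact: perm_inj. Qed.

Lemma exists_moved s : s != 1 -> exists x, s x != x.
Proof.
move=> s1; apply/existsP; apply: contraNT s1 => /existsPn h; apply/eqP/permP => x.
by rewrite perm1; apply/eqP; have := h x; rewrite negbK.
Qed.

Lemma porbit_invariant (rT : Type) (f : T -> rT) s x y :
  (forall z, f (s z) = f z) -> y \in porbit s x -> f y = f x.
Proof.
by move=> fs /porbitP[i ->]; rewrite permX; elim: i => //= i <-.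
Qed.

(** Ree's inequality.  The number of orbits of the group generated by [s] and [t]
    is encoded by a labelling [f] of the points that both preserve: this lets
    the proof undo the transpositions of [t] one at a time.  If undoing one
    increases the number of cycles of both [t] and [s * t], two labels have to be
    merged; otherwise the transposed points lie in one cycle of the shorter
    product, and the labelling is already invariant. *)
Lemma genus_bound s t : exists f : T -> {set T},
  [/\ forall z, f (s z) = f z, forall z, f (t z) = f z &
   (#|porbits s| + #|porbits t| + #|porbits (s * t)|
     <= #|T| + #|f @: [set: T]|.*2)%N].
Proof.
elim/ltn_ind: {t}(#|T| - _)%N {-2}t (erefl (#|T| - #|porbits t|)%N) => k ih t tk.
have [->|/exists_moved[x tx]] := eqVneq t 1.
  exists (porbit s); split=> [z|z|].
  - by rewrite -(porbit_perm s 1 z).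
  - by rewrite perm1.
  - rewrite mulg1 porbits1 (_ : _ @: _ = porbits s); first by rewrite -addnn; lia.
    by apply/setP => c; apply/imsetP/imsetP => -[z _ ->]; exists z.
have xty : x \in porbit t (t x) by rewrite porbit_sym (mem_porbit t 1).
pose u := tperm x (t x).
have xtx : x != t x by rewrite eq_sym.
have tu : #|porbits (t * u)| = #|porbits t|.+1 by rewrite porbits_tperm_split.
have tuT : (#|porbits (t * u)| <= #|T|)%N by exact: leq_imset_card.
have [f [fs ft fb]] := ih (#|T| - #|porbits (t * u)|)%N ltac:(lia) (t * u) erefl.
have tE z : t z = u ((t * u) z) by rewrite permM tpermK.
(* Whether the cycle through [x] of [s * t] is split or merged by the same
   transposition decides between the two cases. *)
have := porbits_mul_tpermr (s * t) x (t x); rewrite xtx -mulgA -/u.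
have [xst|xst] /= := boolP (x \in porbit (s * t) (t x)) => e.
  pose g z := if f z == f (t x) then f x else f z.
  have gu z : g (u z) = g z.
    rewrite /u; case: tpermP => // ->; rewrite /g eqxx; case: eqP => // _.
  exists g; split.
  - by move=> z; rewrite /g fs.
  - by move=> z; rewrite tE gu /g ft.
  have : (#|f @: [set: T]| <= 1 + #|g @: [set: T]|)%N.
    apply: (@leq_trans #|f (t x) |: (g @: [set: T])|); last first.
      by rewrite cardsU1 leq_add2r leq_b1.
    apply/subset_leq_card/subsetP => _ /imsetP[z _ ->]; rewrite !inE.
    have [//|fz] := eqVneq (f z) (f (t x)); apply/imsetP; exists z => //.
    by rewrite /g (negbTE fz).
  move: fb e tu; rewrite -!addnn.
  move: #|porbits (s * t)| #|porbits (s * (t * u))| #|porbits s| #|porbits (t * u)|.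
  move: #|porbits t| #|T| #|f @: [set: T]| #|g @: [set: T]| => *.
  by lia.
exists f; split => // [z|]; last first.
  move: fb e tu; rewrite -!addnn /=.
  move: #|porbits (s * t)| #|porbits (s * (t * u))| #|porbits s| #|porbits (t * u)|.
  by move: #|porbits t| #|T| #|f @: [set: T]| => *; lia.
have fuv : f x = f (t x).
  apply: (@porbit_invariant _ _ (s * (t * u))).
    by move=> y; rewrite permM ft fs.
  apply: contraT => xstu.
  have := porbits_mul_tpermr (s * (t * u)) x (t x).
  rewrite -/u -!mulgA /u tperm2 mulg1 -/u xstu xtx; move: e.
  by move: #|porbits (s * t)| #|porbits (s * (t * u))| => /= *; lia.
by rewrite tE /u -(ft z); case: tpermP => [->|->|].
Qed.

Lemma joint_orbit_invariant (rT : eqType) (f : T -> rT) s t x y :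
  (forall z, f (s z) = f z) -> (forall z, f (t z) = f z) ->
  y \in joint_orbit s t x -> f y = f x.
Proof.
move=> fs ft yx.
have : joint_orbit s t x \subset [set z | f z == f x].
  apply: joint_orbit_min; rewrite ?inE //; apply/stableP => z; rewrite !inE ?fs ?ft //.
by move/subsetP/(_ y yx); rewrite inE => /eqP.
Qed.

Lemma genus_bound_transitive s t x : joint_orbit s t x = [set: T] ->
  (#|porbits s| + #|porbits t| + #|porbits (s * t)| <= #|T| + 2)%N.
Proof.
move=> trans; have [f [fs ft]] := genus_bound s t.
suff : (#|f @: [set: T]| <= 1)%N by move: #|f @: _| => k; rewrite -addnn; lia.
rewrite -(cards1 (f x)); apply/subset_leq_card/subsetP => _ /imsetP[y _ ->].
by rewrite inE; apply/eqP/(joint_orbit_invariant fs ft); rewrite trans.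
Qed.

Lemma genus_parity s t :
  odd (#|porbits s| + #|porbits t| + #|porbits (s * t)|) = odd #|T|.
Proof.
have := odd_permM s t; rewrite /odd_perm !oddD.
by case: (odd #|T|); case: (odd #|porbits s|); case: (odd #|porbits t|);
   case: (odd #|porbits (s * t)|).
Qed.

(** An invariant function with at least as many values as [s] has cycles must take
    different values on different cycles. *)
Lemma invariant_separates (rT : finType) (f : T -> rT) s x y :
  (forall z, f (s z) = f z) -> (#|porbits s| <= #|f @: [set: T]|)%N ->
  f x = f y -> x \in porbit s y.
Proof.
move=> fs cf fxy.
pose F (C : {set T}) := if [pick z in C] is Some z then f z else f x.
have FE z : F (porbit s z) = f z.
  rewrite /F; case: pickP => [w /= wz|/(_ z)]; last by rewrite porbit_id.
  exact: porbit_invariant fs wz.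
have im : F @: porbits s = f @: [set: T].
  apply/setP => c; apply/imsetP/imsetP => [[_ /imsetP[z _ ->] ->]|[z _ ->]].
    by exists z; rewrite ?FE.
  by exists (porbit s z); rewrite ?FE //; apply: imset_f.
have /imset_injP inj : #|F @: porbits s| == #|porbits s|.
  by rewrite eqn_leq leq_imset_card im.
by rewrite -eq_porbit_mem; apply/eqP/inj; rewrite ?imset_f // !FE.
Qed.

Lemma porbit_mul_tperm_sub s i j x : i \in porbit s j ->
  porbit (s * tperm i j) x \subset porbit s x.
Proof.
move=> ij; apply/subsetP => y; apply: contraLR => yx.
suff h z : porbit s ((s * tperm i j) z) = porbit s z.
  apply: contra yx => /(porbit_invariant h) <-; exact: porbit_id.
have ij' : porbit s i = porbit s j by apply/eqP; rewrite eq_porbit_mem.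
rewrite permM -(porbit_perm s 1 z) expg1.
by case: tpermP => [->|->|//].
Qed.

End Genus.

(** * Genus zero factors of a long cycle and noncrossing partitions *)

Local Open Scope group_scope.

(** Number of steps from [x] to [y] on the circle of the residues modulo [n]. *)
Definition circ_dist n (x y : nat) : nat := if x <= y then y - x else y + n - x.

Section CyclicDistance.
Variable n : nat.
Implicit Types x y z i j : nat.

Lemma cdistxx x : circ_dist n x x = 0.
Proof. by rewrite /circ_dist leqnn subnn. Qed.

Lemma cdist0x x : circ_dist n 0 x = x.
Proof. by rewrite /circ_dist subn0. Qed.

Lemma cdist_lt x y : x < n -> y < n -> circ_dist n x y < n.
Proof. by move=> xn yn; rewrite /circ_dist; case: (leqP x y); lia. Qed.

Lemma cdist_gt0 x y : x < n -> x <> y -> 0 < circ_dist n x y.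
Proof. by move=> xn xy; rewrite /circ_dist; case: (leqP x y); lia. Qed.

Lemma cdist_inj x y z : x < n -> y < n -> z < n -> circ_dist n x y = circ_dist n x z -> y = z.
Proof. by move=> xn yn zn; rewrite /circ_dist; case: (leqP x y) => ?; case: (leqP x z) => ?; lia. Qed.

Lemma cdist_trans x y z : x < n -> y < n -> z < n -> circ_dist n x y <= circ_dist n x z ->
  circ_dist n x z = circ_dist n x y + circ_dist n y z.
Proof.
move=> xn yn zn; rewrite /circ_dist.
by case: (leqP x y) => ?; case: (leqP x z) => ?; case: (leqP y z); lia.
Qed.

Lemma cdist_add x y z : x < n -> y < n -> z < n -> circ_dist n x y + circ_dist n y z < n ->
  circ_dist n x z = circ_dist n x y + circ_dist n y z.
Proof.
move=> xn yn zn; rewrite /circ_dist.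
by case: (leqP x y) => ?; case: (leqP x z) => ?; case: (leqP y z); lia.
Qed.

(** Distances only depend on positions counted from an arbitrary origin [i]; the
    arc from [i] to [j] then becomes an initial segment. *)
Lemma cdist_rel i x y : i < n -> x < n -> y < n ->
  circ_dist n x y = circ_dist n (circ_dist n i x) (circ_dist n i y).
Proof.
move=> In xn yn; rewrite /circ_dist.
by case: (leqP i x) => ?; case: (leqP i y) => ?; case: (leqP x y) => ?; case: leqP => ?; lia.
Qed.

(** Here [y] is the successor of [x] in a cycle that also contains the origin [0]
    and [j]: unless it meets one of these two points, the cycle cannot enter or
    leave the arc from [0] to [j]. *)
Lemma arc_next j x y : x < n -> j < n -> y < n -> 0 < j -> y <> j -> y <> 0 ->
  (x <> 0 -> 0 < circ_dist n x y <= circ_dist n x 0) ->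
  (x <> j -> 0 < circ_dist n x y <= circ_dist n x j) -> (y < j) = (x < j).
Proof.
move=> xn jn yn j0 yj y0; have [->|x0] := eqVneq x 0.
  rewrite !cdist0x => _ /(_ ltac:(lia)) h; apply/idP/idP; lia.
move/(_ ltac:(lia)) => h1; have [e|xj] := eqVneq x j.
  move=> _; move: h1; rewrite e /circ_dist.
  by case: (leqP j y) => ?; case: (leqP j 0) => ?; move=> ?; apply/idP/idP; lia.
move/(_ ltac:(lia)); move: h1; rewrite /circ_dist.
by case: (leqP x 0) => ?; case: (leqP x y) => ?; case: (leqP x j) => ?;
  move=> ? ?; apply/idP/idP; lia.
Qed.

Lemma arc_before_end j x : x < n -> j < n -> 0 < j ->
  (x <> 0 -> 0 < circ_dist n x j <= circ_dist n x 0) -> x < j.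
Proof.
move=> xn jn j0; have [->//|x0] := eqVneq x 0; move/(_ ltac:(lia)); rewrite /circ_dist.
by case: (leqP x 0) => ?; case: (leqP x j) => ?; lia.
Qed.

Lemma arc_before_start j x : x < n -> j < n -> 0 < j ->
  (x <> j -> 0 < circ_dist n x 0 <= circ_dist n x j) -> (x < j) = false.
Proof.
move=> xn jn j0; have [->|xj] := eqVneq x j; first by rewrite ltnn.
move/(_ ltac:(lia)); rewrite /circ_dist.
by case: (leqP x 0) => ?; case: (leqP x j) => ?; move=> ?; apply/negbTE; lia.
Qed.

Lemma arc_close j x y : x < n -> j < n -> y < n -> x < j -> y < j -> x <> y ->
  circ_dist n x j <= circ_dist n x y -> 0 < circ_dist n x 0 <= circ_dist n x y.
Proof.
move=> xn jn yn xj yj xy; rewrite /circ_dist.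
by case: (leqP x 0) => ?; case: (leqP x j) => ?; case: (leqP x y) => ? ?; lia.
Qed.

Lemma coarc_close j x y : x < n -> j < n -> y < n -> 0 < j -> j <= x -> j <= y -> x <> y ->
  circ_dist n x 0 <= circ_dist n x y -> 0 < circ_dist n x j <= circ_dist n x y.
Proof.
move=> xn jn yn j0 xj yj xy; rewrite /circ_dist.
by case: (leqP x 0) => ?; case: (leqP x j) => ?; case: (leqP x y) => ? ?; lia.
Qed.

End CyclicDistance.

Section Biane.
Variable n : nat.
Implicit Types (s c : 'S_n) (x y i j : 'I_n).
Local Notation cdist := (circ_dist n).

Lemma ord_neq x y : x != y -> (x : nat) <> y.
Proof. by move=> xy /val_inj/eqP; apply/negP. Qed.

(** The half-open arc which starts at [i] and stops before [j]. *)
Definition cyc_arc i j x := cdist i x < cdist i j.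

(** The successor of [x] is the first element of its cycle met after [x] on the
    circle.  Such a permutation is determined by its cycles
    ([increasing_inj]). *)
Definition increasing s :=
  forall x y, y \in porbit s x -> y != x -> 0 < cdist x (s x) <= cdist x y.

(** Two points of one cycle cut the circle into two arcs; no other cycle meets
    both of them. *)
Definition noncrossing s := forall i j x y,
  j \in porbit s i -> y \in porbit s x -> x \notin porbit s i -> cyc_arc i j x = cyc_arc i j y.

(** Each step towards [y] decreases the distance to [y], so the walk reaches it. *)
Lemma porbit_connected s (U : pred 'I_n) :
  (forall x y, U x -> U y -> y != x -> U (s x) /\ 0 < cdist x (s x) <= cdist x y) ->
  forall x y, U x -> U y -> y \in porbit s x.
Proof.
move=> h x y; elim/ltn_ind: {x}(cdist x y) {-2}x (erefl (cdist x y)) => k ih x xk Ux Uy.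
have [->|yx] := eqVneq y x; first exact: porbit_id.
have [Usx /andP[sx0 sxy]] := h x y Ux Uy yx.
rewrite -(porbit_perm s 1 x) expg1; apply: (ih (cdist (s x) y)) => //.
by rewrite -xk (cdist_trans _ _ _ sxy) // -[X in X < _]add0n ltn_add2r.
Qed.

Lemma increasing_inj s t : increasing s -> increasing t ->
  porbits s = porbits t -> s = t.
Proof.
move=> ss tt st.
have po x : porbit s x = porbit t x.
  have : porbit s x \in porbits t by rewrite -st; apply: imset_f.
  case/imsetP => z _ e; rewrite e; apply/eqP.
  by rewrite eq_porbit_mem porbit_sym -e porbit_id.
have fixed (u v : 'S_n) x : porbit u x = porbit v x -> u x = x -> v x = x.
  move=> uv ux; apply/eqP; rewrite -in_set1.
  suff -> : [set x] = porbit v x by rewrite (mem_porbit v 1).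
  rewrite -uv; apply/setP => y; rewrite inE; apply/eqP/porbitP => [->|[i ->]].
    by exists 0; rewrite expg0 perm1.
  by rewrite permX_fix.
apply/permP => x.
have [sx|sx] := eqVneq (s x) x; first by rewrite sx (fixed s t).
have tx : t x != x by apply: contra_neq sx; exact: fixed.
have sxo : s x \in porbit t x by rewrite -po (mem_porbit s 1).
have txo : t x \in porbit s x by rewrite po (mem_porbit t 1).
have /andP[_ h1] := ss _ _ txo tx; have /andP[_ h2] := tt _ _ sxo sx.
apply/val_inj/(cdist_inj (ltn_ord x) (ltn_ord _) (ltn_ord _))/eqP.
by rewrite eqn_leq h1 h2.
Qed.

(** Multiplying an increasing [c] by the transposition of two points of a cycle cuts
    that cycle along the two arcs they delimit. *)
Lemma arc_mul_tperm c i j x : increasing c -> i != j -> j \in porbit c i ->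
  x \in porbit c i -> cyc_arc i j ((c * tperm i j) x) = cyc_arc i j x.
Proof.
move=> c_inc nij ji.
have c_ji : porbit c j = porbit c i by apply/eqP; rewrite eq_porbit_mem.
move=> xi; rewrite permM.
have ix : i \in porbit c x by rewrite porbit_sym.
have jx : j \in porbit c x.
  by rewrite porbit_sym c_ji.
have inci : x != i -> 0 < cdist x (c x) <= cdist x i.
  by move=> xi'; apply: c_inc => //; rewrite eq_sym.
have incj : x != j -> 0 < cdist x (c x) <= cdist x j.
  by move=> xj'; apply: c_inc => //; rewrite eq_sym.
have J0 : 0 < cdist i j := cdist_gt0 (ltn_ord i) (ord_neq nij).
have rel y : cdist x y = cdist (cdist i x) (cdist i y) by exact: cdist_rel.
have neq0 y : cdist i y <> 0 -> y != i by move=> h; apply/eqP => e; apply: h; rewrite e cdistxx.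
have neqj y : cdist i y <> cdist i j -> y != j by move=> h; apply/eqP => e; apply: h; rewrite e.
have lt y : cdist i y < n by exact: cdist_lt.
rewrite /cyc_arc; case: tpermP => [cx|cx|/eqP cxi /eqP cxj].
- rewrite ltnn [RHS](arc_before_start (lt x) (lt j)) // => h.
  by have := incj (neqj _ h); rewrite cx !rel cdistxx.
- rewrite cdistxx J0 [RHS](arc_before_end (lt x) (lt j)) // => h.
  by have := inci (neq0 _ h); rewrite cx !rel cdistxx.
- have neq (a b : 'I_n) : a != b -> cdist i a <> cdist i b.
    by move=> /eqP ab /(cdist_inj (ltn_ord i) (ltn_ord a) (ltn_ord b))/val_inj.
  apply: arc_next (lt x) (lt j) (lt (c x)) J0 (neq _ _ cxj) _ _ _.
  + by have := neq _ _ cxi; rewrite cdistxx.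
  + by move=> h; have := inci (neq0 _ h); rewrite !rel cdistxx.
  + by move=> h; have := incj (neqj _ h); rewrite !rel.
Qed.

(** Taking [i] out of its cycle in [s], while cutting the cycle of
    [c] through [i] and [s i] in two, preserves all the hypotheses of the
    induction in [noncrossing_genus0]. *)
Section Split.
Variables (s c : 'S_n) (i : 'I_n).
Hypotheses (s_inc : increasing s) (s_nc : noncrossing s) (c_inc : increasing c).
Hypotheses (s_c : forall x, s x \in porbit c x) (si : s i != i).
Let j := s i.
Let s1 := s * tperm i j.
Let c1 := c * tperm i j.

Let ij_s : i \in porbit s j. Proof. by rewrite porbit_sym (mem_porbit s 1). Qed.
Let ij_c : i \in porbit c j. Proof. by rewrite porbit_sym; exact: s_c. Qed.
Let c_ji : porbit c j = porbit c i.
Proof. by apply/eqP; rewrite eq_porbit_mem; exact: s_c. Qed.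
Let nij : i != j. Proof. by rewrite eq_sym. Qed.

Let s_sub_c x : porbit s x \subset porbit c x.
Proof.
apply: porbit_sub; rewrite ?porbit_id //; apply/stableP => y.
rewrite -!eq_porbit_mem; congr (_ == _); apply/eqP.
by rewrite eq_porbit_mem.
Qed.

Let s1i : s1 i = i. Proof. by rewrite permM tpermR. Qed.

Let s1_step x y : y \in porbit s x -> x != i -> y != i -> y != x ->
  s1 x != i /\ 0 < cdist x (s1 x) <= cdist x y.
Proof.
move=> yx xi yi nyx; have sxj : s x != j by rewrite (inj_eq perm_inj).
rewrite permM; case: tpermP => [sx|/eqP|sxi _].
- split; first by rewrite eq_sym.
  have xyi : y \in porbit s i.
    by rewrite -sx -(porbit_perm s 1 x) expg1 in yx *.
  have /andP[xi0 xiy] := s_inc yx nyx; rewrite sx in xi0 xiy.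
  have /andP[ij0 ijy] := s_inc xyi yi; rewrite -/j in ij0 ijy.
  have xy := cdist_trans (ltn_ord x) (ltn_ord i) (ltn_ord y) xiy.
  have lt : cdist x i + cdist i j < n.
    by apply: leq_ltn_trans (cdist_lt (ltn_ord x) (ltn_ord y)); rewrite xy leq_add2l.
  by rewrite (cdist_add _ _ _ lt) // xy leq_add2l ijy addn_gt0 xi0.
- by rewrite (negbTE sxj).
- by split; [exact/eqP|exact: s_inc].
Qed.

Let s1_sub x : porbit s1 x \subset porbit s x.
Proof. exact: porbit_mul_tperm_sub. Qed.

Let c1_sub x : porbit c1 x \subset porbit c x.
Proof. exact: porbit_mul_tperm_sub. Qed.

Let s1_fixed x y : y \in porbit s1 x -> y != x -> x != i /\ y != i.
Proof.
have fixi z : z \in porbit s1 i -> z = i by case/porbitP=> k ->; rewrite permX_fix.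
move=> yx nyx; split; apply: contraNneq nyx => e; rewrite ?e in yx *.
  by rewrite (fixi y).
by rewrite porbit_sym in yx; rewrite (fixi x).
Qed.

Let s1_inc : increasing s1.
Proof.
move=> x y yx nyx; have [xi yi] := s1_fixed yx nyx.
by case: (s1_step (subsetP (s1_sub x) y yx) xi yi nyx).
Qed.

Let s1_conn x y : y \in porbit s x -> x != i -> y != i -> y \in porbit s1 x.
Proof.
move=> yx xi yi.
apply: (@porbit_connected s1 (fun z => (z \in porbit s x) && (z != i))); last first.
- by rewrite yx.
- by rewrite porbit_id.
move=> a b /andP[ax ai] /andP[bx bi] nba.
have bsa : b \in porbit s a.
  by rewrite -eq_porbit_mem (eqP (_ : porbit s b == porbit s x)) ?eq_porbit_mem // porbit_sym.
have [s1a ->] := s1_step bsa ai bi nba; split => //; rewrite s1a andbT.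
have : s1 a \in porbit s a by apply: (subsetP (s1_sub a)); rewrite (mem_porbit s1 1).
by rewrite (eqP (_ : porbit s a == porbit s x)) // eq_porbit_mem.
Qed.

Let s1_nc : noncrossing s1.
Proof.
move=> k l x y lk yx xk.
have [->|nlk] := eqVneq l k; first by rewrite /cyc_arc cdistxx !ltn0.
have [->//|nyx] := eqVneq y x.
have [ki li] := s1_fixed lk nlk; have [xi yi] := s1_fixed yx nyx.
have lk' := subsetP (s1_sub k) l lk; have yx' := subsetP (s1_sub x) y yx.
apply: s_nc => //; apply: contra xk => xk; exact: s1_conn.
Qed.

Let c1_arc x : x \in porbit c i -> cyc_arc i j (c1 x) = cyc_arc i j x.
Proof. by apply: arc_mul_tperm => //; exact: s_c. Qed.

Let c1_step x y : y \in porbit c x -> (x \in porbit c i -> cyc_arc i j x = cyc_arc i j y) ->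
  y != x -> 0 < cdist x (c1 x) <= cdist x y.
Proof.
move=> yx xyarc nyx; have inc := c_inc yx nyx.
have [xi|xi] := boolP (x \in porbit c i); last first.
  rewrite permM; case: tpermP => [cx|cx|//]; case/negP: xi.
    by rewrite -cx porbit_sym (mem_porbit c 1).
  by rewrite -c_ji -cx porbit_sym (mem_porbit c 1).
have {xyarc} := xyarc xi; rewrite permM.
have ix : i \in porbit c x by rewrite porbit_sym.
have jx : j \in porbit c x by rewrite porbit_sym c_ji.
have inci : x != i -> 0 < cdist x (c x) <= cdist x i.
  by move=> xi'; apply: c_inc => //; rewrite eq_sym.
have incj : x != j -> 0 < cdist x (c x) <= cdist x j.
  by move=> xj'; apply: c_inc => //; rewrite eq_sym.
have J0 : 0 < cdist i j := cdist_gt0 (ltn_ord i) (ord_neq nij).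
have rel (z : 'I_n) : cdist x z = cdist (cdist i x) (cdist i z) by exact: cdist_rel.
have neq0 (z : 'I_n) : cdist i z <> 0 -> z != i by move=> h; apply/eqP => e; apply: h; rewrite e cdistxx.
have neqj (z : 'I_n) : cdist i z <> cdist i j -> z != j by move=> h; apply/eqP => e; apply: h; rewrite e.
have lt (z : 'I_n) : cdist i z < n by exact: cdist_lt.
have nxy : cdist i x <> cdist i y.
  by move/(cdist_inj (ltn_ord i) (ltn_ord x) (ltn_ord y))/val_inj => e; rewrite e eqxx in nyx.
rewrite /cyc_arc; case: tpermP => [cx|cx|_ _ //] xyarc.
- have xj : (cdist i x < cdist i j) = false.
    rewrite (arc_before_start (lt x) (lt j)) // => h.
    by have := incj (neqj _ h); rewrite cx !rel cdistxx.
  move/andP: inc => [_]; rewrite cx !rel cdistxx => inc.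
  by apply: coarc_close => //; rewrite leqNgt -?xyarc xj.
- have xj : cdist i x < cdist i j.
    rewrite (arc_before_end (lt x) (lt j)) // => h.
    by have := inci (neq0 _ h); rewrite cx !rel cdistxx.
  move/andP: inc => [_]; rewrite cx !rel cdistxx => inc.
  by apply: (@arc_close _ (cdist i j)) => //; rewrite -xyarc.
Qed.

Let c1_conn x y : y \in porbit c x -> (x \in porbit c i -> cyc_arc i j x = cyc_arc i j y) ->
  y \in porbit c1 x.
Proof.
move=> yx xyarc.
pose U z := (z \in porbit c x) && ((x \in porbit c i) ==> (cyc_arc i j z == cyc_arc i j x)).
apply: (@porbit_connected c1 U); last first.
- by rewrite /U yx; apply/implyP => xi; rewrite xyarc.
- by rewrite /U porbit_id eqxx implybT.
move=> a b /andP[ax /implyP aa] /andP[bx /implyP bb] nba.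
have ca : porbit c a = porbit c x by apply/eqP; rewrite eq_porbit_mem.
have ai : (a \in porbit c i) = (x \in porbit c i).
  by rewrite -!eq_porbit_mem ca.
have bca : b \in porbit c a by rewrite ca.
split; last by apply: c1_step => //; rewrite ai => xi; rewrite (eqP (aa xi)) (eqP (bb xi)).
apply/andP; split.
  by rewrite -ca; apply: (subsetP (c1_sub a)); exact: (mem_porbit c1 1).
by apply/implyP => xi; rewrite c1_arc ?ai // aa.
Qed.

Let c1_orbit_arc x y : y \in porbit c1 x -> x \in porbit c i -> cyc_arc i j x = cyc_arc i j y.
Proof.
move=> yx xi; suff : y \in [set z | (z \in porbit c i) && (cyc_arc i j z == cyc_arc i j x)].
  by rewrite inE => /andP[_ /eqP].
apply: (subsetP _ y yx); apply: porbit_sub; last by rewrite inE xi eqxx.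
apply/stableP => z; rewrite !inE.
have zi : (c1 z \in porbit c i) = (z \in porbit c i).
  rewrite -!eq_porbit_mem; congr (_ == _); apply/eqP; rewrite eq_porbit_mem.
  by apply: (subsetP (c1_sub z)); exact: (mem_porbit c1 1).
by rewrite zi; case: (boolP (z \in _)) => // /c1_arc ->.
Qed.

Let c1_inc : increasing c1.
Proof.
move=> x y yx nyx; apply: c1_step => //; first exact: (subsetP (c1_sub x)).
exact: c1_orbit_arc.
Qed.

Let s1_c1 x : s1 x \in porbit c1 x.
Proof.
have [->|xi] := eqVneq x i; first by rewrite s1i porbit_id.
have s1x : s1 x \in porbit s x by apply: (subsetP (s1_sub x)); exact: (mem_porbit s1 1).
apply: c1_conn; first exact: (subsetP (s_sub_c x)).
have [-> //|ns1x] := eqVneq (s1 x) x; move=> _.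
have [_ s1xi] := s1_fixed (mem_porbit s1 1 x) ns1x; rewrite expg1 in s1xi.
have [xsi|xsi] := boolP (x \in porbit s i).
  have s1xsi : s1 x \in porbit s i.
    by rewrite -(eqP (_ : porbit s x == porbit s i)) // eq_porbit_mem.
  have /andP[_ h1] := s_inc xsi xi; have /andP[_ h2] := s_inc s1xsi s1xi.
  by rewrite /cyc_arc !ltnNge h1 h2.
by apply: s_nc => //; exact: (mem_porbit s 1).
Qed.

Lemma split_cycle : [/\ increasing s1, noncrossing s1, increasing c1 &
  forall x, s1 x \in porbit c1 x].
Proof. by split. Qed.

End Split.

Lemma tperm_quotient s c i j :
  #|porbits ((s * tperm i j)^-1 * (c * tperm i j))| = #|porbits (s^-1 * c)|.
Proof.
rewrite -(porbits_conj (s^-1 * c) (tperm i j)); congr #|porbits _|.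
by rewrite conjgE invMg !mulgA.
Qed.

(** Induction on the number of transpositions needed to write [s]: [split_cycle]
    adds one cycle to [s] and one to [c], and only conjugates the quotient. *)
Lemma noncrossing_genus0 s c : increasing s -> noncrossing s -> increasing c ->
  (forall x, s x \in porbit c x) ->
  #|porbits s| + #|porbits (s^-1 * c)| = n + #|porbits c|.
Proof.
elim/ltn_ind: {s}(n - _) {-2}s c (erefl (n - #|porbits s|)) => k ih s c sk s_inc s_nc c_inc sc.
have [->|/exists_moved[i si]] := eqVneq s 1; first by rewrite invg1 mul1g porbits1 card_ord.
have [s1_inc s1_nc c1_inc s1c1] := split_cycle s_inc s_nc c_inc sc si.
have nij : i != s i by rewrite eq_sym.
have e1 : #|porbits (s * tperm i (s i))| = #|porbits s|.+1.
  by apply: porbits_tperm_split; rewrite // porbit_sym (mem_porbit s 1).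
have e2 : #|porbits (c * tperm i (s i))| = #|porbits c|.+1.
  by apply: porbits_tperm_split; rewrite // porbit_sym.
have le : #|porbits (s * tperm i (s i))| <= n.
  by rewrite -[n in _ <= n]card_ord leq_imset_card.
have := ih _ _ _ _ erefl s1_inc s1_nc c1_inc s1c1.
rewrite tperm_quotient e1 e2 addSn addnS => h; apply: succn_inj; apply: h.
by rewrite -sk; rewrite e1 in le; lia.
Qed.

Definition full_cycle : 'S_n := perm (@ordS_inj n).

Lemma full_cycleE x : full_cycle x = ordS x. Proof. by rewrite permE. Qed.

Lemma cdist_ordS x y : y != x -> 0 < cdist x (ordS x) <= cdist x y.
Proof.
move/ord_neq => yx; have xn := ltn_ord x; have yn := ltn_ord y.
rewrite /=; have [xn1|xn1] := ltnP x.+1 n.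
  rewrite modn_small // /cdist.
  by case: (leqP x x.+1) => ?; case: (leqP x y) => ?; lia.
have -> : x.+1 = n by lia.
rewrite modnn /cdist.
by case: (leqP x 0) => ?; case: (leqP x y) => ?; lia.
Qed.

Lemma full_cycle_connected x y : y \in porbit full_cycle x.
Proof.
apply: (@porbit_connected _ predT) => // a b _ _ nba.
by split=> //; rewrite full_cycleE; exact: cdist_ordS.
Qed.

Lemma full_cycle_increasing : increasing full_cycle.
Proof. by move=> x y _ nyx; rewrite full_cycleE; exact: cdist_ordS. Qed.

Lemma porbits_full_cycle : 0 < n -> #|porbits full_cycle| = 1%N.
Proof.
move=> n0; apply/eqP/cards1P; exists [set: 'I_n]; apply/setP => c; rewrite inE.
have oT x : porbit full_cycle x = [set: 'I_n].
  by apply/setP => y; rewrite full_cycle_connected inE.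
apply/imsetP/eqP => [[x _ ->]|->]; first exact: oT.
by exists (Ordinal n0).
Qed.

Definition genus0 s := #|porbits s| + #|porbits (s^-1 * full_cycle)| == n.+1.

(** Splitting a cycle of [s] at [i] and [j], and the long cycle with it, raises the
    total number of cycles by so much that [genus_bound] rules out a
    connected pair: [s * tperm i j] preserves the two arcs. *)
Lemma genus0_arc s i j : 0 < n -> genus0 s -> i != j -> j \in porbit s i ->
  forall x, cyc_arc i j ((s * tperm i j) x) = cyc_arc i j x.
Proof.
move=> n0 /eqP s0 nij ji x.
have ij : i \in porbit s j by rewrite porbit_sym.
have ijc : i \in porbit full_cycle j by exact: full_cycle_connected.
have e1 := porbits_tperm_split nij ij; have e2 := porbits_tperm_split nij ijc.
rewrite porbits_full_cycle // in e2.
pose s' := s * tperm i j; pose c' := full_cycle * tperm i j.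
(* The cycle counts of [s'] and [c'] are one more than those of [s] and of the
   long cycle, and that of the quotient is unchanged: their sum is [n + 4]. *)
have [f [fs fq]] := genus_bound s' (s'^-1 * c').
rewrite mulKVg tperm_quotient card_ord -/s' -/c' in e1 e2 *; rewrite e1 e2 => fb.
have fc z : f (c' z) = f z by rewrite -{1}(mulKVg s' c') permM fq fs.
have : s' x \in porbit c' x.
  apply: (invariant_separates fc); rewrite ?fs // e2 -leq_double. move: s0 fb.
  move: #|porbits s| #|porbits (s^-1 * full_cycle)| #|f @: [set: 'I_n]| => *; lia.
apply: porbit_invariant => z; apply: arc_mul_tperm => //.
- exact: full_cycle_increasing.
- exact: full_cycle_connected.
- exact: full_cycle_connected.
Qed.

Lemma genus0_increasing s : 0 < n -> genus0 s -> increasing s.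
Proof.
move=> n0 s0 x y yx nyx; have nxy : x != y by rewrite eq_sym.
have h := genus0_arc n0 s0 nxy yx.
have sx : s x != x.
  apply: contra_neq nyx => sx; case/porbitP: yx => i ->; exact: permX_fix.
rewrite (cdist_gt0 (ltn_ord x)); last by apply/ord_neq; rewrite eq_sym.
have := h x; rewrite permM /cyc_arc cdistxx (cdist_gt0 (ltn_ord x) (ord_neq nxy)).
case: tpermP => [e|-> _|_ _]; rewrite ?leqnn //; last exact: ltnW.
by rewrite e eqxx in sx.
Qed.

Lemma genus0_noncrossing s : 0 < n -> genus0 s -> noncrossing s.
Proof.
move=> n0 s0 i j x y ji yx xi.
have [->|nji] := eqVneq j i; first by rewrite /cyc_arc cdistxx !ltn0.
have nij : i != j by rewrite eq_sym.
have h := genus0_arc n0 s0 nij ji.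
have si : porbit s j = porbit s i by apply/eqP; rewrite eq_porbit_mem.
case/porbitP: yx => k ->; elim: k => [|k ->]; first by rewrite expg0 perm1.
have zi : (s ^+ k) x \notin porbit s i by rewrite -eq_porbit_mem porbit_perm eq_porbit_mem.
rewrite -(h ((s ^+ k) x)) permM expgSr permM; case: tpermP => // e; case/negP: zi.
  by rewrite -e porbit_sym (mem_porbit s 1).
by rewrite -si -e porbit_sym (mem_porbit s 1).
Qed.

(** Permutation form of Biane's theorem. *)
Lemma genus0P s : 0 < n -> genus0 s <-> increasing s /\ noncrossing s.
Proof.
move=> n0; split=> [s0|[s_inc s_nc]].
  by split; [exact: genus0_increasing | exact: genus0_noncrossing].
rewrite /genus0 noncrossing_genus0 ?porbits_full_cycle ?addn1 //.
  exact: full_cycle_increasing.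
by move=> x; exact: full_cycle_connected.
Qed.

End Biane.

Lemma partition_porbits (T : finType) (s : {perm T}) : partition (porbits s) [set: T].
Proof.
apply/and3P; split.
- rewrite eqEsubset subsetT /=; apply/subsetP => x _; apply/bigcupP.
  by exists (porbit s x); rewrite ?porbit_id ?imset_f.
- apply/trivIsetP => _ _ /imsetP[x _ ->] /imsetP[y _ ->]; apply: contraR.
  case/pred0Pn => z /andP[/= zx zy].
  by rewrite -(eqP (_ : porbit s z == porbit s x)) ?eq_porbit_mem.
- apply/imsetP => -[x _ e]; have := porbit_id s x; rewrite -e inE.
  by [].
Qed.

Lemma cdist_closest n x y z : x < n -> y < n -> z < n -> x <> y ->
  0 < circ_dist n x z <= circ_dist n x y -> 0 < circ_dist n y z <= circ_dist n y x -> False.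
Proof.
move=> xn yn zn xy; rewrite /circ_dist.
by case: (leqP x y) => ?; case: (leqP y x) => ?; case: (leqP x z) => ?; case: (leqP y z) => ?; lia.
Qed.

Lemma cdist_crossing n i j x y : i < n -> j < n -> x < n -> y < n ->
  i <> x -> i <> y -> j <> x -> j <> y ->
  circ_dist n i x < circ_dist n i j -> circ_dist n i j <= circ_dist n i y ->
  [\/ i < x < j /\ j < y, x < j < y /\ y < i, j < y < i /\ i < x | y < i < x /\ x < j].
Proof.
move=> In jn xn yn ix iy jx jy; rewrite /circ_dist.
case: (leqP i x) => h1; case: (leqP i y) => h2; case: (leqP i j) => h3 h4 h5.
- by constructor 1; lia.
- by lia.
- by constructor 4; lia.
- by constructor 3; lia.
- by lia.
- by lia.
- by lia.
- by constructor 2; lia.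
Qed.

Section NoncrossingPartitions.
Variable n : nat.
Implicit Types (s : 'S_n) (x y i j : 'I_n) (P : {set {set 'I_n}}).
Local Notation cdist := (circ_dist n).

Lemma porbit_of_block s C x : C \in porbits s -> x \in C -> C = porbit s x.
Proof.
case/imsetP => y _ -> xy; apply/esym/eqP; by rewrite eq_porbit_mem.
Qed.

Lemma noncrossing_NC s : noncrossing s -> porbits s \in NC n.
Proof.
move=> s_nc; rewrite !inE partition_porbits /=.
apply/forall_inP => V VP; apply/forall_inP => W WP; apply/implyP => VW.
apply/existsP => -[a /existsP[b /existsP[c /existsP[e]]]].
case/andP=> ab /andP[bc] /andP[ce] /andP[aV] /andP[cV] /andP[bW eW].
have EV := porbit_of_block VP aV; have EW := porbit_of_block WP bW.
have ba : b \notin porbit s a.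
  by apply: contra VW; rewrite EV EW -eq_porbit_mem eq_sym.
have := s_nc a c b e; rewrite -EV -EW => /(_ cV eW); rewrite EV => /(_ ba).
rewrite /cyc_arc /circ_dist; have := ltn_ord e; have := ltn_ord a.
by case: (leqP a b) => ?; case: (leqP a c) => ?; case: (leqP a e) => ?; lia.
Qed.

Section NextInBlock.
Variable P : {set {set 'I_n}}.
Hypothesis PNC : P \in NC n.

Let Ppart : partition P [set: 'I_n].
Proof. by move: PNC; rewrite !inE => /andP[]. Qed.

Let xP x : x \in pblock P x.
Proof. by rewrite mem_pblock (cover_partition Ppart) inE. Qed.

Let same_block x y : y \in pblock P x -> pblock P y = pblock P x.
Proof. exact: same_pblock (partition_trivIset Ppart). Qed.

(** The converse direction of Biane's bijection: within each block, go to the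
    closest element on the circle. *)
Definition next_in_block x : 'I_n :=
  if [pick y in pblock P x :\ x] is Some y0 then
    [arg min_(y < y0 in pblock P x :\ x) cdist x y] else x.

Let next_mem x : next_in_block x \in pblock P x.
Proof.
rewrite /next_in_block; case: pickP => [y0 hy0|//].
by case: arg_minnP => // y; rewrite !inE => /andP[].
Qed.

Let next_min x y : y \in pblock P x -> y != x ->
  0 < cdist x (next_in_block x) <= cdist x y.
Proof.
move=> yx nyx; rewrite /next_in_block; case: pickP => [y0 hy0|/(_ y)]; last first.
  by rewrite !inE nyx yx.
case: arg_minnP => // z; rewrite !inE => /andP[zx _] /(_ y) ->; last by rewrite !inE nyx.
by rewrite andbT cdist_gt0 //; apply/ord_neq; rewrite eq_sym.
Qed.

Let next_inj : injective next_in_block.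
Proof.
move=> x y e; apply/eqP; apply: contraT => nxy.
have xy : pblock P x = pblock P y.
  by rewrite -(same_block (next_mem x)) e (same_block (next_mem y)).
have yx' : y \in pblock P x by rewrite xy.
have xy' : x \in pblock P y by rewrite -xy.
have nyx : y != x by rewrite eq_sym.
have := next_min yx' nyx; have := next_min xy' nxy; rewrite e => h1 h2.
by case: (cdist_closest (ltn_ord x) (ltn_ord y) (ltn_ord (next_in_block y)) (ord_neq nxy)).
Qed.

Definition block_perm : 'S_n := perm next_inj.

Lemma porbit_block_perm x : porbit block_perm x = pblock P x.
Proof.
have stab y : (block_perm y \in pblock P x) = (y \in pblock P x).
  rewrite permE; apply/idP/idP => h; last by rewrite -(same_block h).
  by rewrite -(same_block h) (same_block (next_mem y)).
apply/eqP; rewrite eqEsubset porbit_sub ?xP //=; last exact/stableP.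
apply/subsetP => y yx; apply: (@porbit_connected _ block_perm (fun z => z \in pblock P x)) => //.
move=> a b ax bx nba; rewrite stab ax permE next_min // (same_block ax) //.
Qed.

Lemma porbits_block_perm : porbits block_perm = P.
Proof.
apply/setP => V; apply/imsetP/idP => [[x _ ->]|VP].
  by rewrite porbit_block_perm pblock_mem // (cover_partition Ppart).
have /set0Pn[x xV] := partition_neq0 Ppart VP.
by exists x; rewrite // porbit_block_perm (def_pblock (partition_trivIset Ppart) VP).
Qed.

Lemma block_perm_increasing : increasing block_perm.
Proof.
by move=> x y; rewrite porbit_block_perm permE; exact: next_min.
Qed.

Lemma block_perm_noncrossing : noncrossing block_perm.
Proof.
have nc (a b c e : 'I_n) : a < b -> b < c -> c < e -> c \in pblock P a -> e \in pblock P b ->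
    b \in pblock P a.
  move=> ab bc ce ca eb; have := PNC; rewrite !inE => /andP[_].
  move/forall_inP => /(_ (pblock P a)); rewrite pblock_mem ?(cover_partition Ppart) ?inE //.
  move/(_ isT)/forall_inP => /(_ (pblock P b)).
  rewrite pblock_mem ?(cover_partition Ppart) ?inE // => /(_ isT).
  case: eqVneq => [-> //|_] /= /negP[]; apply/existsP; exists a; apply/existsP; exists b.
  by apply/existsP; exists c; apply/existsP; exists e; rewrite ab bc ce ca eb !xP.
have half i j x y : j \in pblock P i -> y \in pblock P x -> x \notin pblock P i ->
    cyc_arc i j x -> cyc_arc i j y.
  move=> ji yx xi; have bi := same_block ji; have bx := same_block yx.
  have yi : y \notin pblock P i.
    by apply: contra xi => yi; rewrite -(same_block yi) bx.
  have ix : i \notin pblock P x by apply: contra xi => h; rewrite (same_block h).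
  have jx : j \notin pblock P x by apply: contra ix => h; rewrite -(same_block h) bi.
  have ne (a b c : 'I_n) : a \in pblock P c -> b \notin pblock P c -> (a : nat) <> b.
    by move=> ac bc /val_inj e; rewrite -e ac in bc.
  move=> xin; apply: contraT; rewrite /cyc_arc -leqNgt => yout.
  have [] := cdist_crossing (ltn_ord i) (ltn_ord j) (ltn_ord x) (ltn_ord y)
    (ne _ _ _ (xP i) xi) (ne _ _ _ (xP i) yi) (ne _ _ _ ji xi) (ne _ _ _ ji yi) xin yout.
  - by case=> /andP[h1 h2] h3; have := nc _ _ _ _ h1 h2 h3 ji yx; rewrite (negbTE xi).
  - case=> /andP[h1 h2] h3; have := nc _ _ _ _ h1 h2 h3 yx.
    by rewrite bi xP (negbTE jx) => /(_ isT).
  - case=> /andP[h1 h2] h3; have := nc _ _ _ _ h1 h2 h3.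
    by rewrite bi bx !xP (negbTE yi) => /(_ isT isT).
  - case=> /andP[h1 h2] h3; have := nc _ _ _ _ h1 h2 h3.
    by rewrite bx xP ji (negbTE ix) => /(_ isT isT).
move=> i j x y; rewrite !porbit_block_perm => ji yx xi.
apply/idP/idP; first exact: half.
apply: half => //; first by rewrite (same_block yx).
by apply: contra xi => yi; rewrite -(same_block yi) (same_block yx).
Qed.

End NextInBlock.

(** Taking the cycles is a bijection from the genus zero permutations onto the
    noncrossing partitions: it is injective since these permutations are
    increasing, and [block_perm] provides preimages. *)
Lemma sum_genus0_NC (R : comPzRingType) (u : nat -> R) : 0 < n ->
  (\sum_(s : 'S_n | genus0 s) \prod_(c in porbits s) u #|c| =
   \sum_(P in NC n) mult_ext u P)%R.
Proof.
move=> n0.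
have -> : NC n = [set porbits s | s in [set s : 'S_n | genus0 s]].
  apply/setP => P; apply/idP/imsetP => [PNC|[s]]; last first.
    by rewrite inE => s0 ->; apply: noncrossing_NC; exact: genus0_noncrossing.
  exists (block_perm PNC); last by rewrite porbits_block_perm.
  rewrite inE; apply/(genus0P _ n0).
  by split; [exact: block_perm_increasing|exact: block_perm_noncrossing].
rewrite big_imset /=; first by apply: eq_bigl => s; rewrite inE.
move=> s t; rewrite !inE => s0 t0; apply: increasing_inj; exact: genus0_increasing.
Qed.
End NoncrossingPartitions.

Local Close Scope group_scope.
Local Open Scope ring_scope.

(** * The exponential formula for pairs of permutations *)

Section Restriction.
Variable T : finType.
Implicit Types (S A : {set T}) (s t : {perm T}) (x y : T).

(** A permutation of [S] that stabilizes [A] is the product of its restrictions to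
    [A] and to the complement of [A] in [S]. *)
Lemma sum_perm_on_stable (R : nmodType) A S (F : {perm T} -> R) : A \subset S ->
  \sum_(s | perm_on S s && stable A s) F s =
  \sum_(s | perm_on A s) \sum_(t | perm_on (S :\: A) t) F (s * t)%g.
Proof.
move=> AS; rewrite pair_big /=.
have prodL (a b : {perm T}) x : perm_on A a -> perm_on (S :\: A) b ->
    x \in A -> (a * b)%g x = a x.
  move=> p1 p2 xA; rewrite permM (out_perm p2) // inE (perm_closed _ p1) xA.
  by [].
have prodR (a b : {perm T}) x : perm_on A a -> x \notin A ->
    (a * b)%g x = b x.
  by move=> p1 xA; rewrite permM (out_perm p1).
have prod_on (p : {perm T} * {perm T}) : perm_on A p.1 -> perm_on (S :\: A) p.2 ->
    perm_on S (p.1 * p.2)%g && stable A (p.1 * p.2)%g.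
  move=> p1 p2; apply/andP; split.
    apply: perm_onM; first exact: subset_trans p1 AS.
    exact: subset_trans p2 (subsetDl _ _).
  apply: stableM; first exact: perm_on_stable.
  apply/stableP => x; have [xA|xA] := boolP (x \in A).
    by rewrite (out_perm p2) ?xA // inE xA.
  have [xS|xS] := boolP (x \in S :\: A).
    have := perm_closed x p2; rewrite xS inE => /andP[/negbTE -> _] //.
  by rewrite (out_perm p2) // (negbTE xA).
rewrite (reindex_onto (fun p => (p.1 * p.2)%g)
   (fun s => (restr_perm A s, restr_perm (S :\: A) s))) /=; last first.
  move=> s /andP[sS sA]; have sSA := stableD (perm_on_stable sS) sA.
  apply/permP => x; have [xA|xA] := boolP (x \in A).
    by rewrite prodL ?restr_perm_on //= restr_permE // astabs_stable.
  rewrite prodR ?restr_perm_on //=.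
  have [xS|xS] := boolP (x \in S :\: A).
    by rewrite restr_permE // astabs_stable.
  rewrite (out_perm (restr_perm_on _ _) xS) (out_perm sS) //.
  by apply: contra xS; rewrite inE xA.
apply: eq_bigl => -[s t] /=; apply/andP/andP => [[_ /eqP[<- <-]]|[p1 p2]].
  by rewrite !restr_perm_on.
have /andP[pS pA] := prod_on (s, t) p1 p2.
have pSA := stableD (perm_on_stable pS) pA.
rewrite pS pA; split => //; apply/eqP; congr (_, _); apply/permP => x.
  have [xA|xA] := boolP (x \in A); last first.
    by rewrite (out_perm (restr_perm_on _ _)) // (out_perm p1).
  by rewrite restr_permE ?astabs_stable // prodL.
have [xA|xA] := boolP (x \in S :\: A); last first.
  by rewrite (out_perm (restr_perm_on _ _)) // (out_perm p2).
rewrite restr_permE ?astabs_stable // prodR //.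
by move: xA; rewrite inE => /andP[].
Qed.

End Restriction.

Section CycleWeights.
Variables (R : comPzRingType) (T : finType).
Implicit Types (S A : {set T}) (s t : {perm T}) (x y : T) (u v : nat -> R).

(** Only the cycles inside [S] count, so that the weight is multiplicative over
    stable parts of [S] and ignores the fixed points outside [S]. *)
Definition cycle_weight u S s : R := \prod_(c in [set porbit s x | x in S]) u #|c|.

Lemma cycle_weightT u s : cycle_weight u [set: T] s = \prod_(c in porbits s) u #|c|.
Proof.
apply: eq_bigl => c; apply/imsetP/imsetP => -[x _ ->]; by exists x; rewrite ?inE.
Qed.

Lemma eq_cycle_weight u S s t : {in S, s =1 t} -> stable S s ->
  cycle_weight u S s = cycle_weight u S t.
Proof.
move=> st Ss; rewrite /cycle_weight.
suff -> : [set porbit s x | x in S] = [set porbit t x | x in S] by [].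
by apply: eq_in_imset => x xS; apply: eq_porbit st Ss xS.
Qed.

Lemma cycle_weight0 u s : cycle_weight u set0 s = 1.
Proof. by rewrite /cycle_weight imset0 big_set0. Qed.

Lemma cycle_weightD u S A s : A \subset S -> stable S s -> stable A s ->
  cycle_weight u S s = cycle_weight u A s * cycle_weight u (S :\: A) s.
Proof.
move=> AS Ss As; rewrite /cycle_weight.
have -> : [set porbit s x | x in S] =
    [set porbit s x | x in A] :|: [set porbit s x | x in S :\: A].
  by rewrite -imsetU -[in LHS](setID S A) (setIidPr AS).
rewrite -bigU /=; first by apply: eq_bigl => c; rewrite inE.
rewrite disjoints_subset; apply/subsetP => c /imsetP[x xA ->].
rewrite inE; apply/imsetP => -[y]; rewrite inE => /andP[yA _] e.
case/negP: yA; apply: (subsetP (porbit_sub As xA)); rewrite e; exact: porbit_id.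
Qed.

Definition perm_sum u S := \sum_(s | perm_on S s) cycle_weight u S s.

Definition transitive_sum u v S x :=
  \sum_(s | perm_on S s) \sum_(t | perm_on S t && (joint_orbit s t x == S))
    cycle_weight u S s * cycle_weight v S t.

Lemma perm_sum0 u : perm_sum u set0 = 1.
Proof.
rewrite /perm_sum (big_pred1 1%g) ?cycle_weight0 // => s.
apply/idP/eqP => [s0|->]; last exact: perm_on1.
by apply: (perm_on_id s0); rewrite cards0.
Qed.

(** The exponential formula: classify the pairs of permutations of [S] by the joint
    orbit [A] of [x]; such a pair is a transitive pair on [A] together with an
    arbitrary pair on the complement. *)
Lemma transitive_sum_rec u v S x : x \in S ->
  perm_sum u S * perm_sum v S =
  \sum_(A : {set T} | (x \in A) && (A \subset S))
    transitive_sum u v A x * (perm_sum u (S :\: A) * perm_sum v (S :\: A)).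
Proof.
move=> xS; rewrite /perm_sum big_distrl /=.
under eq_bigr => s _ do rewrite big_distrr /=.
rewrite pair_big /=.
rewrite (partition_big (fun p => joint_orbit p.1 p.2 x)
          (fun A => (x \in A) && (A \subset S))) /=; last first.
  move=> [s t] /= /andP[sS tS]; rewrite joint_orbit_id joint_orbit_min //;
    exact: perm_on_stable.
apply: eq_bigr => A /andP[xA AS].
transitivity (\sum_(s | perm_on S s && stable A s) \sum_(t | perm_on S t && stable A t)
   (if joint_orbit s t x == A then cycle_weight u S s * cycle_weight v S t else 0)).
  rewrite pair_big -big_mkcondr; apply: eq_bigl => -[s t] /=.
  have [e|] := boolP (joint_orbit s t x == A); last by rewrite !andbF.
  have As := joint_orbit_stablel s t x; have At := joint_orbit_stabler s t x.
  by move: As At; rewrite (eqP e) => -> ->; rewrite !andbT.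
rewrite sum_perm_on_stable // /transitive_sum big_distrl; apply: eq_bigr => s sA.
rewrite big_mkcondr big_distrl /=.
transitivity (\sum_(s' | perm_on (S :\: A) s') \sum_(t | perm_on A t)
  \sum_(t' | perm_on (S :\: A) t')
  (if joint_orbit s t x == A then cycle_weight u A s * cycle_weight v A t *
     (cycle_weight u (S :\: A) s' * cycle_weight v (S :\: A) t') else 0)).
  apply: eq_bigr => s' s'A; rewrite sum_perm_on_stable //.
  have agree (a b : {perm T}) : perm_on A a -> perm_on (S :\: A) b ->
    {in A, a =1 (a * b)%g} /\ {in S :\: A, b =1 (a * b)%g}.
    move=> aA bA; split=> y yA.
      by rewrite permM (out_perm bA) // inE (perm_closed _ aA) yA.
    by rewrite permM (out_perm aA) //; move: yA; rewrite inE => /andP[].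
  have stab (a b : {perm T}) : perm_on A a -> perm_on (S :\: A) b ->
    stable A b /\ stable S (a * b)%g.
    move=> aA bA; split.
      apply/stableP => y; have [yA|yA] := boolP (y \in S :\: A).
        have := perm_closed y bA; rewrite yA; move: yA; rewrite !inE.
        by case/andP=> /negbTE -> _ /andP[/negbTE -> _].
      by rewrite (out_perm bA).
    apply: perm_on_stable; apply: perm_onM.
      exact: subset_trans aA AS.
    exact: subset_trans bA (subsetDl _ _).
  apply: eq_bigr => t tA; apply: eq_bigr => t' t'A.
  have [es es'] := agree _ _ sA s'A; have [et et'] := agree _ _ tA t'A.
  have [ss ss'] := stab _ _ sA s'A; have [st st'] := stab _ _ tA t'A.
  have sAs := perm_on_stable sA; have sAt := perm_on_stable tA.
  rewrite -(@eq_joint_orbit _ A s t) ?stableM //; case: ifP => // _.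
  rewrite (cycle_weightD _ AS ss' (stableM sAs ss)).
  rewrite (cycle_weightD _ AS st' (stableM sAt st)).
  rewrite -!(eq_cycle_weight _ es) -?(eq_cycle_weight _ es')
          -?(eq_cycle_weight _ et) -?(eq_cycle_weight _ et') ?perm_on_stable //.
  by rewrite mulrACA.
rewrite exchange_big; apply: eq_bigr => t tA.
case: ifP => _; last first.
  by rewrite mul0r big1 // => ? _; rewrite big1.
rewrite big_distrl /= big_distrr; apply: eq_bigr => s' _ /=.
by rewrite big_distrr /= big_distrr.
Qed.

End CycleWeights.

Section SubsetSums.
Variables (R : nmodType) (T : finType).

Lemma sum_subset_card (B : {set T}) (h : nat -> R) :
  \sum_(A : {set T} | A \subset B) h #|A| =
  \sum_(j < #|B|.+1) h j *+ 'C(#|B|, j).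
Proof.
rewrite (partition_big (fun A : {set T} => inord #|A| : 'I_#|B|.+1) predT) //=.
apply: eq_bigr => j _; rewrite -cards_draws -sum1dep_card -sumrMnr.
apply: eq_big => [A|A /andP[AB /eqP <-]]; rewrite ?mulr1n.
  have [AB|//] := boolP (A \subset B); rewrite !andTb.
  by rewrite -val_eqE /= inordK // ltnS subset_leq_card.
by rewrite inordK // ltnS subset_leq_card.
Qed.

Lemma sum_subset_card_pointed (S : {set T}) x (g : nat -> nat -> R) : x \in S ->
  \sum_(A : {set T} | (x \in A) && (A \subset S)) g #|A| #|S :\: A| =
  \sum_(j < #|S|) g j.+1 (#|S| - j.+1)%N *+ 'C(#|S|.-1, j).
Proof.
move=> xS.
rewrite (reindex_onto (fun A => x |: A) (fun A => A :\ x)) /=; last first.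
  by move=> A /andP[xA _]; rewrite setD1K.
rewrite (eq_bigl (fun A : {set T} => A \subset S :\ x)); last first.
  move=> A; rewrite setU11 /= subsetD1 subUset sub1set xS /=.
  case: (A \subset S) => //=; have [xA|xA] := boolP (x \in A).
    by apply/eqP => e; have := setD11 x (x |: A); rewrite e xA.
  by rewrite setU1K ?eqxx.
have cS : #|S :\ x|.+1 = #|S| by rewrite [in RHS](cardsD1 x S) xS.
rewrite (eq_bigr (fun A : {set T} => g #|A|.+1 (#|S| - #|A|.+1)%N)); last first.
  move=> A AS; have xA : x \notin A.
    by apply/negP => /(subsetP AS); rewrite setD11.
  by rewrite cardsDS ?cardsU1 ?xA // subUset sub1set xS (subset_trans AS (subD1set _ _)).
rewrite (sum_subset_card _ (fun k => g k.+1 (#|S| - k.+1)%N)).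
by rewrite -cS.
Qed.

End SubsetSums.

Section Recursion.
Variable F : numFieldType.
Implicit Types (u v alpha beta : nat -> F).

(** The relation [z * alpha' = alpha * \sum_j beta_j z ^ j] between generating
    series, at the coefficient of [z ^ k]. *)
Definition exp_rec alpha beta k :=
  k%:R * alpha k = \sum_(j < k) beta j.+1 * alpha (k - j.+1)%N.

Lemma exp_rec_fact alpha beta k : (0 < k)%N -> exp_rec alpha beta k ->
  k`!%:R * alpha k = \sum_(j < k)
    (j`!%:R * beta j.+1 * ((k - j.+1)`!%:R * alpha (k - j.+1)%N)) *+ 'C(k.-1, j).
Proof.
case: k => // k _ rec; rewrite factS natrM mulrAC [_ * alpha _]rec mulrC mulr_sumr.
apply: eq_bigr => j _; rewrite subSS /=.
have jk : (j <= k)%N by rewrite -ltnS.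
rewrite -(bin_fact jk) !natrM -[RHS]mulr_natr; ring.
Qed.

Section Sets.
Variable T : finType.
Implicit Types (S A : {set T}) (s t : {perm T}) (x : T).

(** The recursion determines the sums over all pairs from the sums over transitive
    pairs. *)
Lemma perm_sum_of_transitive_sum u v alpha beta : alpha 0%N = 1 ->
  (forall k, (0 < k)%N -> exp_rec alpha beta k) ->
  (forall S x, x \in S -> transitive_sum u v S x = (#|S|.-1)`!%:R * beta #|S|) ->
  forall S, perm_sum u S * perm_sum v S = #|S|`!%:R * alpha #|S|.
Proof.
move=> a0 rec h S.
elim/ltn_ind: {S}#|S| {-2}S (erefl #|S|) => n ih S Sn.
have [->|[x xS]] := set_0Vmem S; first by rewrite !perm_sum0 cards0 a0 !mul1r.
have S0 : (0 < #|S|)%N by apply/card_gt0P; exists x.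
rewrite (transitive_sum_rec _ _ xS) (exp_rec_fact S0 (rec _ S0)).
rewrite -(sum_subset_card_pointed (fun i j => i.-1`!%:R * beta i * (j`!%:R * alpha j)) xS).
apply: eq_bigr => A /andP[xA AS]; rewrite h //; congr (_ * _).
apply: (ih #|S :\: A|) => //; rewrite -Sn; apply: proper_card.
apply/properP; split; first exact: subsetDl.
by exists x => //; rewrite inE xA.
Qed.

(** Conversely the recursion can be solved for its leading term, the sum over
    transitive pairs on the whole of [S].  The bound [d] is there because the
    coefficients of a polynomial of degree [d] satisfy the recursion only up to
    [d]. *)
Lemma transitive_sum_of_perm_sum u v alpha beta d : alpha 0%N = 1 ->
  (forall k, (0 < k <= d)%N -> exp_rec alpha beta k) ->
  (forall S, (#|S| <= d)%N -> perm_sum u S * perm_sum v S = #|S|`!%:R * alpha #|S|) ->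
  forall S x, x \in S -> (#|S| <= d)%N ->
    transitive_sum u v S x = (#|S|.-1)`!%:R * beta #|S|.
Proof.
move=> a0 rec h S x.
elim/ltn_ind: {S}#|S| {-2}S (erefl #|S|) => n ih S Sn xS Sd.
have S0 : (0 < #|S|)%N by apply/card_gt0P; exists x.
have Sd' : (0 < #|S| <= d)%N by rewrite S0 Sd.
have := exp_rec_fact S0 (rec _ Sd').
rewrite -(h _ Sd) (transitive_sum_rec _ _ xS).
rewrite -(sum_subset_card_pointed (fun i j => i.-1`!%:R * beta i * (j`!%:R * alpha j)) xS).
have xSS : (x \in S) && (S \subset S) by rewrite xS subxx.
rewrite !(bigD1 S xSS) /= setDv !perm_sum0 cards0 a0 !mulr1.
rewrite (eq_bigr (fun A => #|A|.-1`!%:R * beta #|A| *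
   (#|S :\: A|`!%:R * alpha #|S :\: A|))); first by move/addIr; rewrite Sn.
move=> A /andP[/andP[xA AS] AnS].
have ltA : (#|A| < #|S|)%N by rewrite proper_card // properEneq AnS.
rewrite h ?(leq_trans (subset_leq_card (subsetDl _ _))) //.
by rewrite (ih #|A|) -?Sn //; exact: leq_trans (ltnW ltA) Sd.
Qed.

Definition full_cycles S x := [set s : {perm T} | perm_on S s & porbit s x == S].

(** Weighting the second permutation by [delta1] forces it to be the identity,
    which reduces pairs of permutations to single ones. *)
Definition delta1 (j : nat) : F := (j == 1)%:R.

Lemma cycle_weight_delta1 S t : perm_on S t -> cycle_weight delta1 S t = (t == 1%g)%:R.
Proof.
move=> tS; have [->|t1] := eqVneq t 1%g.
  rewrite /cycle_weight big1 // => c /imsetP[x _ ->].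
  suff -> : porbit 1 x = [set x] by rewrite cards1.
  apply/setP => y; rewrite inE; apply/porbitP/eqP => [[i ->]|->].
    by rewrite expg1n perm1.
  by exists 0%N; rewrite perm1.
have /existsP[x tx] : [exists x, t x != x].
  apply: contraNT t1 => /existsPn h; apply/eqP/permP => x; rewrite perm1.
  by apply/eqP; have := h x; rewrite negbK.
have xS : x \in S by apply: contraNT tx => /(out_perm tS) ->.
rewrite /cycle_weight (bigD1 (porbit t x)) /=; last by apply: imset_f.
rewrite /delta1 (_ : (_ == _) = false) ?mul0r //; apply: contraNF tx => /cards1P[y e].
by rewrite -in_set1 -(_ : porbit t x = [set x]) ?(mem_porbit t 1) // e;
  have := porbit_id t x; rewrite e => /set1P ->.
Qed.

Lemma perm_sum_delta1 S : perm_sum delta1 S = 1.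
Proof.
rewrite /perm_sum (bigD1 1%g) ?perm_on1 //= cycle_weight_delta1 ?perm_on1 // eqxx.
by rewrite big1 ?addr0 // => s /andP[sS /negbTE s1]; rewrite cycle_weight_delta1 // s1.
Qed.

Lemma joint_orbit1 s x : joint_orbit s 1%g x = porbit s x.
Proof.
apply/eqP; rewrite eqEsubset joint_orbit_min ?porbit_id ?stable_porbit //=.
  by rewrite porbit_sub ?joint_orbit_id ?joint_orbit_stablel.
by apply/stableP => y; rewrite perm1.
Qed.

Lemma cycle_weight_full u S s x : x \in S -> porbit s x = S -> cycle_weight u S s = u #|S|.
Proof.
move=> xS e; rewrite /cycle_weight (_ : [set _ | _ in _] = [set S]) ?big_set1 //.
apply/setP => c; rewrite inE; apply/imsetP/eqP => [[y yS ->]|->]; last by exists x.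
by rewrite -e; apply/eqP; rewrite eq_porbit_mem e.
Qed.

Lemma transitive_sum_delta1 u S x : x \in S ->
  transitive_sum u delta1 S x = #|full_cycles S x|%:R * u #|S|.
Proof.
move=> xS; rewrite /transitive_sum mulr_natl -sumr_const.
rewrite [RHS](eq_bigl (fun s => perm_on S s && (porbit s x == S))); last by move=> s; rewrite inE.
rewrite [RHS]big_mkcondr; apply: eq_bigr => s sS.
rewrite big_mkcondr (bigD1 1%g) ?perm_on1 //= joint_orbit1 [X in _ + X]big1; last first.
  move=> t /andP[tS /negbTE t1]; rewrite cycle_weight_delta1 // t1 mulr0.
  by case: ifP.
rewrite addr0 cycle_weight_delta1 ?perm_on1 // eqxx mulr1; case: ifP => // /eqP.
exact: cycle_weight_full.
Qed.

(** With all weights equal to [1], the exponential formula counts permutations by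
    the cycle of [x], and the number of cyclic permutations can be read off. *)
Lemma card_full_cycles S x : x \in S -> #|full_cycles S x| = (#|S|.-1)`!.
Proof.
move=> xS; apply/eqP; rewrite -(eqr_nat F) -[_%:R]mulr1.
rewrite -(transitive_sum_delta1 (fun=> 1) xS).
rewrite (@transitive_sum_of_perm_sum _ _ (fun=> 1) (fun=> 1) #|S|) ?mulr1 //.
  by move=> k _; rewrite /exp_rec; under eq_bigr do rewrite mulr1;
    rewrite sumr_const card_ord mulr1.
move=> A _; rewrite perm_sum_delta1 !mulr1 -card_perm -sum1_card natr_sum.
apply: eq_bigr => s _; rewrite /cycle_weight big1 //.
Qed.

Lemma perm_sum_exp_rec u alpha : alpha 0%N = 1 ->
  (forall k, (0 < k)%N -> exp_rec alpha u k) ->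
  forall S, perm_sum u S = #|S|`!%:R * alpha #|S|.
Proof.
move=> a0 rec S; have := @perm_sum_of_transitive_sum u delta1 _ _ a0 rec _ S.
rewrite perm_sum_delta1 mulr1; apply=> A x xA.
by rewrite transitive_sum_delta1 // card_full_cycles.
Qed.

(** Both sides have the exponential generating series [(1 - z) ^ d]. *)
Lemma perm_sum_const (d : nat) S :
  perm_sum (fun=> - d%:R : F) S = (-1) ^+ #|S| * (d ^_ #|S|)%:R.
Proof.
rewrite (@perm_sum_exp_rec _ (fun k => (-1) ^+ k * 'C(d, k)%:R)) ?bin0 ?mulr1 //.
  by rewrite mulrCA -natrM mulnC bin_ffact.
move=> k _; rewrite /exp_rec -mulr_sumr.
rewrite -(big_mkord predT (fun j => (-1) ^+ (k - j.+1) * 'C(d, k - j.+1)%:R)).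
rewrite big_nat_rev /= add0n (eq_big_nat _ _ (F2 := fun j => (-1) ^+ j * 'C(d, j)%:R)).
  elim: k => [|k ih]; first by rewrite big_nil mulr0 mul0r.
  rewrite big_nat_recr //= mulrDr -ih exprS.
  have : (k.+1 * 'C(d, k.+1))%:R = (d%:R - k%:R) * 'C(d, k)%:R :> F.
    rewrite mul_bin_left; have [kd|dk] := leqP k d; first by rewrite natrM natrB.
    by rewrite bin_small // muln0 mulr0.
  rewrite natrM => e; transitivity (- ((-1) ^+ k * (k.+1%:R * 'C(d, k.+1)%:R)) : F).
    by ring.
  by rewrite e; ring.
by move=> j /andP[_ jk]; rewrite subnSK // subKn // ltnW.
Qed.

End Sets.
End Recursion.

(** * Inversion of the moment-cumulant relation over set partitions *)

Section PartitionSums.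
Variables (R : comPzRingType) (g e : nat -> R).

Definition partition_sum (T : finType) (S : {set T}) : R :=
  \sum_(P : {set {set T}} | partition P S) g #|P| * \prod_(V in P) e #|V|.

Lemma partition_sum_imset (T T' : finType) (f : T -> T') (S : {set T}) :
  injective f -> partition_sum (f @: S) = partition_sum S.
Proof.
move=> fI; rewrite /partition_sum.
rewrite (reindex_onto (fun P : {set {set T}} => [set f @: (B : {set T}) | B in P])
  (fun Q => [set f @^-1: (B : {set T'}) | B in Q])) /=; last first.
  move=> Q Qpart; rewrite -imset_comp -[RHS]imset_id; apply: eq_in_imset => B BQ /=.
  apply/setP => y; apply/imsetP/idP => [[x]|yB]; first by rewrite inE => ? ->.
  have /imsetP[x xS yx] := subsetP (partitionS Qpart BQ) _ yB.
  by exists x => //; rewrite inE -yx.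
have fK (P : {set {set T}}) :
    [set f @^-1: (B : {set T'}) | B in [set f @: (B : {set T}) | B in P]] = P.
  rewrite -imset_comp -[RHS]imset_id; apply: eq_imset => B /=.
  by apply/setP => x; rewrite inE mem_imset.
apply: eq_big => [P|P _]; first by rewrite fK eqxx andbT imset_partition.
rewrite card_imset; last exact: imset_inj.
rewrite big_imset /=; last by move=> A B _ _; exact: imset_inj.
by congr (_ * _); apply: eq_bigr => V _; rewrite card_imset.
Qed.

(** So partitions of a set may be replaced by partitions of an ordinal, over which
    the finite free cumulants are defined. *)
Lemma partition_sum_card (T : finType) (S : {set T}) :
  partition_sum S = partition_sum [set: 'I_#|S|].
Proof.
rewrite -(partition_sum_imset _ (@enum_val_inj T (mem S))); congr partition_sum.
apply/setP => x; apply/idP/imsetP => [xS|[i _ ->]]; last exact: enum_valP.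
by exists (enum_rank_in xS x); rewrite ?inE // enum_rankK_in.
Qed.

Lemma sum_partition_block (T : finType) (S V : {set T}) (G : {set {set T}} -> R) :
  V != set0 -> V \subset S ->
  \sum_(P : {set {set T}} | partition P (S :\: V)) G (V |: P) =
  \sum_(P : {set {set T}} | partition P S && (V \in P)) G P.
Proof.
move=> V0 VS.
rewrite [RHS](reindex_onto (fun P => V |: P) (fun P => P :\ V)) /=; last first.
  by move=> P /andP[_ VP]; rewrite setD1K.
apply: eq_bigl => P; rewrite setU11 andbT.
have VSV : V :|: S :\: V = S by rewrite -{2}(setID S V) (setIidPr VS).
apply/idP/andP => [PS|[PS /eqP <-]].
  have VP : V \notin P.
    apply/negP => VP; case/set0Pn: V0 => x xV.
    by have := subsetP (partitionS PS VP) x xV; rewrite inE xV.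
  rewrite setU1K // eqxx; split => //; rewrite -VSV.
  apply: partitionU1 => //; rewrite disjoints_subset.
  by apply/subsetP => x xV; rewrite !inE xV.
by apply: partitionD1 => //; rewrite setU11.
Qed.

End PartitionSums.

(** The derivatives at [1] of the logarithm, i.e. the values of the Moebius function
    of the lattice of set partitions. *)
Definition log_coef (R : pzRingType) (m : nat) : R := (-1) ^+ m.-1 * m.-1`!%:R.

(** The identity [E' = E * (log E)'] between generating series, read on sums over
    partitions.  A nonempty [V = S :\: A] is a block avoiding [x] of a partition
    of [S] with [k] blocks, and there are [k - 1] choices of [V]: the
    coefficients cancel since [log_coef k = - (k - 1) * log_coef (k - 1)],
    except for the partition with one block. *)
Lemma moment_cumulant_rec (R : comPzRingType) (e : nat -> R) (T : finType) (S : {set T}) x :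
  e 0%N = 1 -> x \in S ->
  \sum_(A : {set T} | (x \in A) && (A \subset S))
    partition_sum (@log_coef R) e A * e #|S :\: A| = e #|S|.
Proof.
move=> e0 xS.
have xSS : (x \in S) && (S \subset S) by rewrite xS subxx.
rewrite (bigD1 S xSS) /= setDv cards0 e0 mulr1.
rewrite (reindex_onto (fun V => S :\: V) (fun A => S :\: A)) /=; last first.
  by move=> A /andP[/andP[_ AS] _]; rewrite setDDr setDv set0U (setIidPr AS).
have cond V : (x \in S :\: V) && (S :\: V \subset S) && (S :\: V != S)
      && (S :\: (S :\: V) == V) = [&& V != set0, V \subset S & x \notin V].
  rewrite inE xS andbT subsetDl andbT setDDr setDv set0U.
  rewrite -andbA (sameP eqP setIidPr); case: (boolP (V \subset S)) => VS; rewrite ?andbF //=.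
  have -> : (S :\: V == S) = (V == set0).
    apply/eqP/eqP => [E|->]; last by rewrite setD0.
    apply/eqP; rewrite -subset0; apply/subsetP => y yV.
    by have := subsetP VS y yV; rewrite -{1}E inE yV.
  by rewrite andbT andbC.
rewrite (eq_bigl _ _ cond).
pose G (P : {set {set T}}) := log_coef R #|P|.-1 * \prod_(V in P) e #|V|.
have block (V : {set T}) : V != set0 -> V \subset S ->
   partition_sum (@log_coef R) e (S :\: V) * e #|S :\: (S :\: V)| =
   \sum_(P : {set {set T}} | partition P S && (V \in P)) G P.
  move=> V0 VS; rewrite -sum_partition_block // big_distrl; apply: eq_bigr => P PS /=.
  have VP : V \notin P.
    apply/negP => VP; case/set0Pn: V0 => y yV.
    by have := subsetP (partitionS PS VP) y yV; rewrite inE yV.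
  rewrite /G cardsU1 VP /= big_setU1 //= setDDr setDv set0U (setIidPr VS).
  by rewrite mulrCA mulrC.
rewrite (eq_bigr (fun V => \sum_(P : {set {set T}} | partition P S && (V \in P)) G P));
  last by move=> V /and3P[V0 VS _]; apply: block.
rewrite (exchange_big_dep (fun P => partition P S)) /=; last by move=> V P _ /andP[].
rewrite /partition_sum -big_split /=.
rewrite (eq_bigr (fun P : {set {set T}} =>
   (log_coef R #|P| + log_coef R #|P|.-1 *+ #|P|.-1) * \prod_(V in P) e #|V|)); last first.
  move=> P PS; rewrite mulrDl; congr (_ + _).
  transitivity (\sum_(V in P :\ pblock P x) G P); last first.
    rewrite sumr_const mulrnAl; congr (_ *+ _).
    by rewrite [in RHS](cardsD1 (pblock P x)) pblock_mem ?(cover_partition PS).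
  apply: eq_bigl => V; rewrite PS !inE /= andbC; have [VP|] := boolP (V \in P); last by rewrite andbF.
  rewrite andbT /=.
  have -> : V != set0 by apply: contraTneq VP => ->; rewrite (partition0 PS).
  rewrite (partitionS PS VP) /=; congr (~~ _); apply/idP/eqP => [xV|->].
    by rewrite (def_pblock (partition_trivIset PS) VP xV).
  by rewrite mem_pblock (cover_partition PS).
have S0 : S != set0 by apply/set0Pn; exists x.
have P1 : partition [set S] S.
  apply/and3P; split; first by rewrite /cover big_set1.
    exact: trivIset1.
  by rewrite inE eq_sym.
rewrite (bigD1 [set S] P1) /= [X in _ + X]big1 ?addr0.
  by rewrite cards1 big_set1 /log_coef /= expr0 mulr0n addr0 mulr1 mul1r.
move=> P /andP[PS PnS].
have : (1 < #|P|)%N.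
  rewrite ltnNge; apply: contra PnS => P1'; apply/eqP.
  have [V VP] : exists V, V \in P.
    by exists (pblock P x); rewrite pblock_mem ?(cover_partition PS).
  have PV : P = [set V] by apply/eqP; rewrite eq_sym eqEcard sub1set VP cards1.
  by have := cover_partition PS; rewrite PV /cover big_set1 => ->.
case: #|P| => [|[|m]] // _; rewrite /log_coef /= exprS factS natrM -[_ *+ m.+1]mulr_natr; ring.
Qed.

(** * Newton's identities *)

Section Newton.
Variable R : comNzRingType.
Implicit Types (s : seq R).

(** The product with its coefficients reversed: indices then count from the top
    degree, which makes an induction on the roots possible. *)
Definition reciprocal_prod s : {poly R} := \prod_(z <- s) (1 - z *: 'X).

Lemma coef_reciprocal_cons z s k :
  (reciprocal_prod (z :: s))`_k =
  (reciprocal_prod s)`_k - z * (if k is k'.+1 then (reciprocal_prod s)`_k' else 0).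
Proof.
rewrite /reciprocal_prod big_cons mulrBl mul1r coefB -scalerAl coefZ coefXM.
by case: k.
Qed.

Lemma reciprocal_prod_overflow s k : (size s < k)%N -> (reciprocal_prod s)`_k = 0.
Proof.
elim: s k => [|z s ih] [|k] //= sk.
  by rewrite /reciprocal_prod big_nil coef1.
by rewrite coef_reciprocal_cons !ih ?mulr0 ?subr0 // ltnW.
Qed.

Lemma coef_prod_XsubC_rev s k : (k <= size s)%N ->
  (\prod_(z <- s) ('X - z%:P))`_(size s - k) = (reciprocal_prod s)`_k.
Proof.
elim: s k => [|z s ih] k.
  by rewrite leqn0 => /eqP ->; rewrite /reciprocal_prod !big_nil.
rewrite coef_reciprocal_cons big_cons mulrBl coefB coefXM mul_polyC coefZ /= => ks.
have top : (\prod_(z <- s) ('X - z%:P))`_(size s).+1 = 0.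
  by apply/leq_sizeP: (leqnn (size s).+1); rewrite size_prod_XsubC.
case: k ks => [_|k]; first by rewrite subn0 /= top mulr0 -ih // subn0.
rewrite ltnS subSS leq_eqVlt => /orP[/eqP ->|ks].
  rewrite subnn /= sub0r reciprocal_prod_overflow // sub0r.
  by rewrite -(ih (size s)) // subnn.
by rewrite subn_eq0 leqNgt ks /= -subnS ih // ih // ltnW.
Qed.

(** Induction on the list of roots; the contribution of a new root [z] is a
    geometric sum that telescopes. *)
Lemma newton_reciprocal s k :
  k%:R * (reciprocal_prod s)`_k =
  \sum_(j < k) - (\sum_(z <- s) z ^+ j.+1) * (reciprocal_prod s)`_(k - j.+1).
Proof.
elim: s k => [|z s ih] k.
  rewrite big1 => [|j _]; last by rewrite big_nil oppr0 mul0r.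
  rewrite /reciprocal_prod big_nil coef1.
  by case: k => [|k]; rewrite ?mul0r // mulr0.
case: k => [|k]; first by rewrite big_ord0 mul0r.
pose r := reciprocal_prod s; pose r' := reciprocal_prod (z :: s).
have r'E i : r'`_i.+1 = r`_i.+1 - z * r`_i by rewrite [LHS]coef_reciprocal_cons.
have r'0 : r'`_0 = r`_0 by rewrite [LHS]coef_reciprocal_cons mulr0 subr0.
have ih' i : i%:R * r`_i = \sum_(j < i) - (\sum_(y <- s) y ^+ j.+1) * r`_(i - j.+1).
  exact: ih.
have geom : \sum_(j < k.+1) z ^+ j.+1 * r'`_(k.+1 - j.+1) = z * r`_k.
  elim: (k) => [|i ihi]; first by rewrite big_ord1 subnn r'0 expr1.
  rewrite big_ord_recl subn1 /= r'E expr1.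
  rewrite (eq_bigr (fun j : 'I_i.+1 => z * (z ^+ j.+1 * r'`_(i.+1 - j.+1)))).
    by rewrite -mulr_sumr ihi; ring.
  by move=> j _; rewrite /= /bump add1n subSS exprS mulrA.
have conv : \sum_(j < k.+1) - (\sum_(y <- s) y ^+ j.+1) * r'`_(k.+1 - j.+1)
    = k.+1%:R * r`_k.+1 - z * (k%:R * r`_k).
  rewrite !ih' big_ord_recr [in RHS]big_ord_recr /= subnn r'0 mulr_sumr.
  rewrite addrAC -sumrB; congr (_ + _); apply: eq_bigr => j _.
  by rewrite subSn // r'E; ring.
rewrite -/r' (eq_bigr (fun j : 'I_k.+1 =>
  - (\sum_(y <- s) y ^+ j.+1) * r'`_(k.+1 - j.+1) - z ^+ j.+1 * r'`_(k.+1 - j.+1))).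
  by rewrite sumrB geom conv r'E -natr1; ring.
by move=> j _; rewrite big_cons; ring.
Qed.

Lemma newton_prod_XsubC s k : (k <= size s)%N ->
  let p := \prod_(z <- s) ('X - z%:P) in
  k%:R * p`_(size s - k) =
  \sum_(j < k) - (\sum_(z <- s) z ^+ j.+1) * p`_(size s - (k - j.+1)).
Proof.
move=> ks /=; rewrite coef_prod_XsubC_rev // newton_reciprocal.
apply: eq_bigr => j _; rewrite coef_prod_XsubC_rev //.
exact: leq_trans (leq_subr _ _) ks.
Qed.

End Newton.

(** * Transitive pairs with the largest total numbers of cycles *)

Section Conjugation.
Variable T : finType.
Implicit Types (s t g h : {perm T}) (x y : T).

Lemma prod_porbits_conj (R : comPzRingType) (u : nat -> R) s h :
  \prod_(c in porbits (s ^ h)%g) u #|c| = \prod_(c in porbits s) u #|c|.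
Proof.
rewrite porbits_conjE big_imset /=; last by move=> ? ? _ _; apply: imset_inj; exact: perm_inj.
by apply: eq_bigr => c _; rewrite card_imset //; exact: perm_inj.
Qed.

Lemma stable_conj (S : {set T}) s h : stable (h @: S) (s ^ h)%g = stable S s.
Proof.
have mem x : (h x \in h @: S) = (x \in S) by rewrite mem_imset //; exact: perm_inj.
apply/stableP/stableP => st x; first by have := st (h x); rewrite permJ !mem.
by rewrite -(permKV h x) permJ !mem st.
Qed.

Lemma stableC (S : {set T}) s : stable S s -> stable (~: S) s.
Proof. by move/stableP => h; apply/stableP => x; rewrite !inE h. Qed.

(** Quantified over all base points, so that invariance under conjugation is
    immediate. *)
Definition jointly_transitive s t := [forall x, joint_orbit s t x == [set: T]].

(** One base point suffices: the joint orbit of [y] and its complement are both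
    stable. *)
Lemma jointly_transitiveP s t x : jointly_transitive s t = (joint_orbit s t x == [set: T]).
Proof.
apply/forallP/eqP => [/(_ x)/eqP //|e y]; apply/eqP/setP => z; rewrite inE.
have [xy|xy] := boolP (x \in joint_orbit s t y).
  have sub : joint_orbit s t x \subset joint_orbit s t y; last first.
    by apply: (subsetP sub); rewrite e inE.
  exact: joint_orbit_min (joint_orbit_stablel _ _ _) (joint_orbit_stabler _ _ _).
have : joint_orbit s t x \subset ~: joint_orbit s t y.
  apply: joint_orbit_min; rewrite ?inE //; apply: stableC.
    exact: joint_orbit_stablel.
  exact: joint_orbit_stabler.
by rewrite e => /subsetP/(_ y); rewrite !inE joint_orbit_id => /(_ isT).
Qed.

Lemma jointly_transitive_stable s t : reflect
  (forall A : {set T}, A != set0 -> stable A s -> stable A t -> A = [set: T])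
  (jointly_transitive s t).
Proof.
apply: (iffP forallP) => [trans A /set0Pn[x xA] As At|h x].
  by apply/eqP; rewrite eqEsubset subsetT -(eqP (trans x)) joint_orbit_min.
apply/eqP; apply: h; rewrite ?joint_orbit_stablel ?joint_orbit_stabler //.
by apply/set0Pn; exists x; exact: joint_orbit_id.
Qed.

Lemma jointly_transitive_conj s t h :
  jointly_transitive (s ^ h)%g (t ^ h)%g = jointly_transitive s t.
Proof.
have sub (s1 t1 h1 : {perm T}) : jointly_transitive s1 t1 -> jointly_transitive (s1 ^ h1)%g (t1 ^ h1)%g.
  move/jointly_transitive_stable => trans; apply/jointly_transitive_stable => A A0 As At.
  have hA : h1 @: ((h1^-1)%g @: A) = A.
    rewrite -imset_comp -[RHS]imset_id; apply: eq_imset => x /=; exact: permKV.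
  rewrite -hA stable_conj in As; rewrite -hA stable_conj in At.
  rewrite -hA (trans _ _ As At) ?imset_eq0 //.
  apply/setP => x; rewrite inE; apply/imsetP.
  by exists ((h1^-1)%g x); rewrite ?permKV.
apply/idP/idP; last exact: sub.
by move/(sub _ _ (h^-1)%g); rewrite -!conjgM !mulgV !conjg1.
Qed.

Lemma jointly_transitive_mulV s g : jointly_transitive s (s^-1 * g)%g = jointly_transitive s g.
Proof.
apply/jointly_transitive_stable/jointly_transitive_stable => h A A0 As Ag; apply: h => //.
  by apply: stableM => //; exact: stableV.
by rewrite -(mulKVg s g); apply: stableM.
Qed.

(** Link with the transitivity of the generated group used in [S_NC]. *)
Lemma transitiveE s t : [transitive <<[set s; t]>>, on [set: T] | 'P] =
  (0 < #|T|)%N && jointly_transitive s t.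
Proof.
have gen A : stable A s -> stable A t -> [acts <<[set s; t]>>, on A | 'P]%g.
  move=> As At; rewrite gen_subG; apply/subsetP => g /set2P[->|->]; exact: astabs_stable.
have orbst (g : {perm T}) x : g \in [set s; t] -> stable (orbit 'P <<[set s; t]>>%g x) g.
  move=> gst; apply/stableP => y.
  have gG : g \in <<[set s; t]>>%g by apply: mem_gen.
  by rewrite -[g y]/('P%act y g) orbit_actr.
apply/imsetP/andP => [[x _ e]|[/card_gt0P[x _] /jointly_transitive_stable trans]].
  split; first by apply/card_gt0P; exists x.
  apply/jointly_transitive_stable => A /set0Pn[y yA] As At.
  apply/eqP; rewrite eqEsubset subsetT e.
  have /orbit_eqP <- : y \in orbit 'P <<[set s; t]>>%g x by rewrite -e inE.
  by rewrite (acts_sub_orbit _ (gen A As At)).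
exists x => //; apply/esym/trans.
- by apply/set0Pn; exists x; exact: orbit_refl.
- by apply: orbst; rewrite !inE eqxx.
- by apply: orbst; rewrite !inE eqxx orbT.
Qed.

End Conjugation.

Section PairSums.
Variables (R : comPzRingType) (u : nat -> R) (T : finType).
Implicit Types (s t g h : {perm T}) (x y : T).

Definition perm_weight s : R := \prod_(c in porbits s) u #|c|.

(** The contribution to [pair_sum k] of the pairs with product [g]; a class function
    of [g]. *)
Definition factor_sum k g : R :=
  \sum_(s | jointly_transitive s g && (#|porbits s| + #|porbits (s^-1 * g)%g| == k)%N)
    perm_weight s.

Definition pair_sum k : R :=
  \sum_s \sum_(t | jointly_transitive s t && (#|porbits s| + #|porbits t| == k)%N)
    perm_weight s.

Lemma pair_sumE k : pair_sum k = \sum_g factor_sum k g.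
Proof.
rewrite /factor_sum (exchange_big_dep predT) //=; apply: eq_bigr => s _.
rewrite (reindex_inj (mulgI (s^-1)%g)) /=; apply: eq_bigl => g.
by rewrite jointly_transitive_mulV.
Qed.

Lemma factor_sum_conj k g h : factor_sum k (g ^ h)%g = factor_sum k g.
Proof.
rewrite /factor_sum (reindex_inj (conjg_inj h)) /=; apply: eq_big => s.
  by rewrite jointly_transitive_conj -conjVg -conjMg !porbits_conj.
by move=> _; rewrite /perm_weight prod_porbits_conj.
Qed.

Lemma factor_sum_bound k g : (0 < #|T|)%N -> (#|T| + 2 < k + #|porbits g|)%N ->
  factor_sum k g = 0.
Proof.
case/card_gt0P => x _ kg; rewrite /factor_sum big_pred0 // => s.
apply/negP => /andP[]; rewrite -jointly_transitive_mulV (jointly_transitiveP _ _ x) => /eqP trans /eqP sk.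
by move: kg; rewrite ltnNge -sk -[X in (_ + #|porbits X|)%N](mulKVg s g) (genus_bound_transitive trans).
Qed.

Lemma factor_sum_parity k g : odd (k + #|porbits g|) != odd #|T| -> factor_sum k g = 0.
Proof.
move=> kg; rewrite /factor_sum big_pred0 // => s; apply/negP => /andP[_ /eqP sk].
case/eqP: kg; rewrite -sk -[X in (_ + #|porbits X|)%N](mulKVg s g); exact: genus_parity.
Qed.

Lemma porbit_iter_inj g x i j : (i < #|porbit g x|)%N -> (j < #|porbit g x|)%N ->
  (g ^+ i)%g x = (g ^+ j)%g x -> i = j.
Proof.
move=> Hi Hj; rewrite !permX -(nth_traject g Hi) -(nth_traject g Hj) => /eqP.
rewrite nth_uniq ?size_traject ?uniq_traject_porbit //; exact/eqP.
Qed.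

Lemma porbits_gt0 g x : (0 < #|porbits g|)%N.
Proof. by apply/card_gt0P; exists (porbit g x); apply: imset_f. Qed.

End PairSums.

(** By the genus bound only the [n]-cycles contribute; they are all conjugate to
    [full_cycle n], and their number is [(n - 1)!]. *)
Lemma pair_sum_genus0 (R : comPzRingType) (u : nat -> R) n : (0 < n)%N ->
  pair_sum u 'I_n n.+1 = n.-1`!%:R * \sum_(P in NC n) mult_ext u P.
Proof.
move=> n0; pose x0 := Ordinal n0.
have T0 : (0 < #|'I_n|)%N by rewrite card_ord.
have single g : porbit g x0 = [set: 'I_n] <-> (#|porbits g| <= 1)%N.
  split=> [e|g1].
    rewrite -(cards1 [set: 'I_n]); apply/subset_leq_card/subsetP => _ /imsetP[y _ ->].
    by rewrite inE -e eq_porbit_mem e inE.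
  have := porbits_gt0 g x0; move: g1; case E : #|porbits g| => [|[|]] // _ _.
  have /eqP/cards1P[C eC] := E.
  apply/setP => y; rewrite inE -eq_porbit_mem.
  have mem z : porbit g z \in porbits g by apply: imset_f.
  by have := mem x0; have := mem y; rewrite eC => /set1P -> /set1P ->; rewrite eqxx.
rewrite pair_sumE (bigID [pred g | g \in full_cycles [set: 'I_n] x0]) /= [X in _ + X]big1 ?addr0.
  have -> : \sum_(P in NC n) mult_ext u P = factor_sum u n.+1 (full_cycle n).
    rewrite -sum_genus0_NC //; apply: eq_bigl => s; rewrite /genus0.
    suff -> : jointly_transitive s (full_cycle n) by [].
    apply/jointly_transitive_stable => A /set0Pn[y yA] _ Ac.
    apply/setP => z; rewrite inE; apply: (subsetP (porbit_sub Ac yA)).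
    exact: full_cycle_connected.
  rewrite (eq_bigr (fun=> factor_sum u n.+1 (full_cycle n))).
    (* The count is obtained inside a numerical field; [rat] is an arbitrary
       choice. *)
    have := card_full_cycles rat (in_setT x0); rewrite cardsT card_ord => <-.
    by rewrite sumr_const mulr_natl.
  move=> g; rewrite !inE => /andP[_ /eqP gx].
  have on : #|porbit g x0| = n by rewrite gx cardsT card_ord.
  have hI : injective (fun i : 'I_n => (g ^+ i)%g x0).
    by move=> i j /porbit_iter_inj e; apply/val_inj/e; rewrite on.
  rewrite -(factor_sum_conj _ _ (full_cycle n) (perm hI)); congr (factor_sum _ _ _).
  apply/permP => y; rewrite -(permKV (perm hI) y) permJ full_cycleE.
  move: (((perm hI)^-1)%g y) => i; rewrite !permE /= -permM -expgSr.
  have [i1|] := ltnP i.+1 n; first by rewrite modn_small.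
  move=> ni; have -> : i.+1 = n by apply/eqP; rewrite eqn_leq ltn_ord ni.
  rewrite modnn !permX /=; have := iter_porbit g x0; rewrite on => ->.
  by [].
move=> g; rewrite !inE /= => /negP gx; apply: factor_sum_bound => //.
have : ~ (#|porbits g| <= 1)%N.
  by move/single => e; apply: gx; rewrite e eqxx andbT; apply/subsetP => y; rewrite inE.
rewrite card_ord; move: #|porbits g| => k; lia.
Qed.

Section TwoCycles.
Variables (T : finType) (g : {perm T}).
Hypothesis g2 : #|porbits g| = 2%N.

Lemma porbits_pair x y : y \notin porbit g x -> porbits g = [set porbit g x; porbit g y].
Proof.
move=> yx; apply/esym/eqP; rewrite eqEcard subUset !sub1set !imset_f //= g2 cards2.
by rewrite eq_sym eq_porbit_mem yx.
Qed.

Lemma card_porbit_compl x y : y \notin porbit g x -> (#|porbit g x| + #|porbit g y|)%N = #|T|.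
Proof.
move=> yx; rewrite -cardsT (card_partition (partition_porbits g)) (porbits_pair yx).
by rewrite big_setU1 ?big_set1 // inE eq_sym eq_porbit_mem.
Qed.

Lemma exists_other_porbit x : exists y, y \notin porbit g x.
Proof.
apply/existsP; apply: contraT => /existsPn h.
have : (#|porbits g| <= 1)%N.
  rewrite -(cards1 (porbit g x)); apply/subset_leq_card/subsetP => _ /imsetP[y _ ->].
  by rewrite inE eq_porbit_mem; have := h y; rewrite negbK.
by rewrite g2.
Qed.

End TwoCycles.

Lemma sum_inv_card_porbit (F : numFieldType) (T : finType) (g : {perm T}) :
  \sum_x (#|porbit g x|%:R)^-1 = #|porbits g|%:R :> F.
Proof.
rewrite (eq_bigl (fun x => x \in [set: T])); last by move=> x; rewrite inE.
rewrite (set_partition_big _ (partition_porbits g)) -sumr_const.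
apply: eq_bigr => C /imsetP[x _ ->].
rewrite (eq_bigr (fun=> (#|porbit g x|%:R)^-1)).
  by rewrite sumr_const -[_ *+ _]mulr_natr mulVf // pnatr_eq0 card_porbit_neq0.
by move=> y; rewrite -eq_porbit_mem => /eqP ->.
Qed.

(** Pairs of base points, the first one in a cycle of length [t], the second one
    outside of it. *)
Definition cross_pairs (T : finType) (g : {perm T}) t :=
  [set p : T * T | (p.2 \notin porbit g p.1) && (#|porbit g p.1| == t)].

Lemma card_cross_pairs (T : finType) (g : {perm T}) t :
  #|cross_pairs g t| = (\sum_(x | #|porbit g x| == t) (#|T| - t))%N.
Proof.
rewrite (eq_bigr (fun x => \sum_(y | y \notin porbit g x) 1)%N) => [|x /eqP <-].
  rewrite pair_big_dep /= sum1dep_card; apply: eq_card => p; by rewrite !inE andbC.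
by rewrite sum1dep_card -(cardC (mem (porbit g x))) addKn; apply: eq_card => y; rewrite !inE.
Qed.

(** A point [x] in a cycle of length [t] belongs to [n - t] such pairs, so the sum
    is that of the inverse lengths of the cycles of all points, which is the
    number of cycles. *)
Lemma sum_card_cross_pairs (F : numFieldType) n (g : 'S_n) : #|porbits g| = 2%N ->
  \sum_(1 <= t < n) #|cross_pairs g t|%:R / (t * (n - t))%:R = 2%:R :> F.
Proof.
move=> g2; transitivity (\sum_x (#|porbit g x|%:R)^-1 : F); last first.
  by rewrite sum_inv_card_porbit g2.
rewrite (eq_big_nat _ _ (F2 := fun t => \sum_(x | t == #|porbit g x|) (t%:R)^-1)); last first.
  move=> t /andP[t0 tn]; rewrite card_cross_pairs card_ord natr_sum mulr_suml.
  apply: eq_big => x; first by rewrite eq_sym.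
  move=> _; rewrite natrM invfM mulrCA mulfV ?mulr1 //.
  by rewrite pnatr_eq0 -lt0n subn_gt0.
rewrite (exchange_big_dep xpredT) //=; apply: eq_bigr => x _.
rewrite big_nat1_eq; case: ifP => // /negbT; rewrite lt0n card_porbit_neq0 /= -leqNgt => nx.
have [y yx] := exists_other_porbit g2 x.
have := card_porbit_compl g2 yx; have := card_porbit_neq0 g y; rewrite card_ord; move: nx.
move: #|porbit g x| #|porbit g y| => k l; lia.
Qed.

Section AnnularPair.
Variables (t r : nat).
Hypotheses (t0 : (0 < t)%N) (r0 : (0 < r)%N).
Local Notation gamma := (gamma t r).
Let a0 : 'I_(t + r) := lshift r (Ordinal t0).
Let b0 : 'I_(t + r) := rshift t (Ordinal r0).

Let gammal i : gamma (lshift r i) = lshift r (ordS i).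
Proof. by rewrite permE /gamma_fun -[lshift r i]/(unsplit (inl i)) unsplitK. Qed.

Let gammar i : gamma (rshift t i) = rshift t (ordS i).
Proof. by rewrite permE /gamma_fun -[rshift t i]/(unsplit (inr i)) unsplitK. Qed.

Let gammaXl (i : 'I_t) : (gamma ^+ i)%g a0 = lshift r i.
Proof.
case: i => i /= Hi; elim: i Hi => [|i ih] Hi.
  by rewrite expg0 perm1; apply: val_inj.
rewrite expgSr permM (ih (ltnW Hi)) gammal; apply: val_inj.
by rewrite /= modn_small.
Qed.

Let gammaXr (i : 'I_r) : (gamma ^+ i)%g b0 = rshift t i.
Proof.
case: i => i /= Hi; elim: i Hi => [|i ih] Hi.
  by rewrite expg0 perm1; apply: val_inj.
rewrite expgSr permM (ih (ltnW Hi)) gammar; apply: val_inj.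
by rewrite /= modn_small.
Qed.

Let porbitl : porbit gamma a0 = (@lshift t r) @: [set: 'I_t].
Proof.
apply/eqP; rewrite eqEsubset; apply/andP; split; last first.
  by apply/subsetP => _ /imsetP[i _ ->]; rewrite -gammaXl mem_porbit.
apply/subsetP => _ /porbitP[i ->]; elim: i => [|i /imsetP[j _]].
  by rewrite expg0 perm1 imset_f.
by rewrite expgSr permM => ->; rewrite gammal imset_f.
Qed.

Let porbitr : porbit gamma b0 = (@rshift t r) @: [set: 'I_r].
Proof.
apply/eqP; rewrite eqEsubset; apply/andP; split; last first.
  by apply/subsetP => _ /imsetP[i _ ->]; rewrite -gammaXr mem_porbit.
apply/subsetP => _ /porbitP[i ->]; elim: i => [|i /imsetP[j _]].
  by rewrite expg0 perm1 imset_f.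
by rewrite expgSr permM => ->; rewrite gammar imset_f.
Qed.

Let card_porbitl : #|porbit gamma a0| = t.
Proof. by rewrite porbitl card_imset ?cardsT ?card_ord //; exact: lshift_inj. Qed.

Let b0_a0 : b0 \notin porbit gamma a0.
Proof. by rewrite porbitl; apply/imsetP => -[i _ /eqP]; rewrite eq_rlshift. Qed.

Lemma porbits_gamma : #|porbits gamma| = 2%N.
Proof.
have -> : porbits gamma = [set porbit gamma a0; porbit gamma b0].
  apply/setP => C; rewrite !inE; apply/imsetP/orP => [[x _ ->]|[/eqP->|/eqP->]].
  - rewrite !eq_porbit_mem porbitl porbitr -(splitK x).
    by case: (split x) => i /=; [left|right]; rewrite imset_f.
  - by exists a0.
  - by exists b0.
by rewrite cards2 eq_sym eq_porbit_mem b0_a0.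
Qed.

(** A permutation conjugating [gamma] to [g] is determined by the images of one base
    point in each of the two cycles of [gamma], and any two points in different
    cycles of [g] of the right lengths occur. *)
Lemma card_conj_gamma (g : 'S_(t + r)) : #|porbits g| = 2%N ->
  #|[set h | (gamma ^ h)%g == g]| = #|cross_pairs g t|.
Proof.
move=> g2; pose f (h : 'S_(t + r)) := (h a0, h b0).
rewrite -(@card_in_imset _ _ f).
  congr #|pred_of_set _|; apply/setP => -[x y]; rewrite inE /=; apply/imsetP/idP.
    move=> [h]; rewrite inE => /eqP <- [-> ->].
    rewrite !porbit_conj mem_imset ?b0_a0 /=; last exact: perm_inj.
    by rewrite card_imset ?card_porbitl //; exact: perm_inj.
  case/andP=> yx /eqP gx; have := card_porbit_compl g2 yx.
  rewrite gx card_ord => /addnI gy.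
  (* Follow the cycle of [g] through [x], then the one through [y]. *)
  pose hf (z : 'I_(t + r)) :=
    match split z with inl i => (g ^+ i)%g x | inr j => (g ^+ j)%g y end.
  have hfl i : hf (lshift r i) = (g ^+ i)%g x.
    by rewrite /hf -[lshift r i]/(unsplit (inl i)) unsplitK.
  have hfr i : hf (rshift t i) = (g ^+ i)%g y.
    by rewrite /hf -[rshift t i]/(unsplit (inr i)) unsplitK.
  have mixed i j : (g ^+ i)%g x <> (g ^+ j)%g y.
    move=> e; case/negP: yx.
    by rewrite -eq_porbit_mem -(porbit_perm g j y) -e porbit_perm.
  have hI : injective hf.
    move=> z w; rewrite -(splitK z) -(splitK w).
    case: (split z) => i; case: (split w) => j /=; rewrite ?hfl ?hfr.
    - by move/porbit_iter_inj => e; congr (lshift _ _); apply/val_inj/e; rewrite gx.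
    - by move/mixed.
    - by move/esym/mixed.
    - by move/porbit_iter_inj => e; congr (rshift _ _); apply/val_inj/e; rewrite gy.
  have step n z k : #|porbit g z| = n -> (k < n)%N -> (g ^+ (k.+1 %% n))%g z = g ((g ^+ k)%g z).
    move=> gz kn; rewrite -permM -expgSr; have [k1|nk] := ltnP k.+1 n; first by rewrite modn_small.
    have -> : k.+1 = n by apply/eqP; rewrite eqn_leq kn nk.
    by rewrite modnn !permX /=; have := iter_porbit g z; rewrite gz => ->.
  exists (perm hI); last by rewrite /f !permE hfl hfr !expg0 !perm1.
  rewrite inE; apply/eqP/permP => z; rewrite -(permKV (perm hI) z) permJ.
  move: (((perm hI)^-1)%g z) => w; rewrite !(permE hI) -(splitK w).
  case: (split w) => i /=; rewrite ?gammal ?gammar ?hfl ?hfr; exact: step.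
move=> h k; rewrite !inE => /eqP hg /eqP kg [ea eb]; apply/permP => z.
have X (i : nat) (w : 'I_(t + r)) : h w = k w -> h ((gamma ^+ i)%g w) = k ((gamma ^+ i)%g w).
  by move=> e; rewrite -(permJ _ h w) -(permJ _ k w) !conjXg hg kg e.
by rewrite -(splitK z); case: (split z) => i /=; rewrite -?gammaXl -?gammaXr; exact: X.
Qed.

Lemma sum_S_NC (R : comPzRingType) (u : nat -> R) :
  \sum_(s in S_NC t r) mult_ext_perm u s = factor_sum u (t + r) gamma.
Proof.
apply: eq_bigl => s; rewrite inE transitiveE card_ord.
by rewrite addn_gt0 t0.
Qed.

(** Average the class function [factor_sum] over all conjugates of [gamma]. *)
Lemma sum_S_NC_conj (R : comPzRingType) (u : nat -> R) :
  (t + r)`!%:R * \sum_(s in S_NC t r) mult_ext_perm u s =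
  \sum_(g : 'S_(t + r) | #|porbits g| == 2%N) factor_sum u (t + r) g *+ #|cross_pairs g t|.
Proof.
rewrite sum_S_NC; have -> : (t + r)`! = #|{: 'S_(t + r)}| by rewrite card_Sn.
rewrite mulr_natl -sumr_const (eq_bigr (fun h => factor_sum u (t + r) (gamma ^ h)%g)); last first.
  by move=> h _; rewrite factor_sum_conj.
rewrite (partition_big (fun h => (gamma ^ h)%g) (fun g => #|porbits g| == 2%N)) /=; last first.
  by move=> h _; rewrite porbits_conj porbits_gamma.
apply: eq_bigr => g /eqP g2.
rewrite -card_conj_gamma // (eq_bigr (fun=> factor_sum u (t + r) g)); last by move=> h /eqP ->.
by rewrite sumr_const; congr (_ *+ _); apply: eq_card => h; rewrite !inE.
Qed.

End AnnularPair.

Section PairSumOrdinal.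
Variable F : numFieldType.
Implicit Types (u : nat -> F).

Lemma sum_S_NC_cross_pairs u n t r : (0 < t)%N -> (0 < r)%N -> n = (t + r)%N ->
  n`!%:R * \sum_(s in S_NC t r) mult_ext_perm u s =
  \sum_(g : 'S_n | #|porbits g| == 2%N) factor_sum u n g *+ #|cross_pairs g t|.
Proof. by move=> t0 r0 ->; exact: sum_S_NC_conj. Qed.

(** The permutations [g] with two cycles are weighted by [sum_card_cross_pairs], which
    gives [2] for each of them; a single cycle is excluded by parity, three or
    more by the genus bound. *)
Lemma pair_sum_annular u n : (0 < n)%N ->
  pair_sum u 'I_n n = n`!%:R / 2%:R *
    \sum_(1 <= t < n) \sum_(s in S_NC t (n - t)) mult_ext_perm u s / (t * (n - t))%:R.
Proof.
move=> n0; rewrite mulrAC mulr_sumr.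
rewrite (eq_big_nat _ _ (F2 := fun t => \sum_(g : 'S_n | #|porbits g| == 2%N)
    factor_sum u n g * (#|cross_pairs g t|%:R / (t * (n - t))%:R))); last first.
  move=> t /andP[t0 tn]; rewrite -mulr_suml mulrA.
  rewrite (sum_S_NC_cross_pairs _ t0 (r := n - t)%N) ?subn_gt0 ?subnKC // 1?ltnW //.
  rewrite mulr_suml; apply: eq_bigr => g _.
  by rewrite -[factor_sum _ _ _ *+ _]mulr_natr mulrA.
rewrite exchange_big /=.
under eq_bigr => g /eqP g2 do rewrite -mulr_sumr (sum_card_cross_pairs F g2).
rewrite -mulr_suml mulfK ?pnatr_eq0 // pair_sumE [RHS]big_mkcond.
apply: eq_bigr => g _; case: eqP => // g2.
pose x0 := Ordinal n0; have g0 := porbits_gt0 g x0.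
have [g3|] := ltnP 2%N #|porbits g|.
  by apply: factor_sum_bound; rewrite card_ord //; lia.
move=> g3; have g1 : #|porbits g| = 1%N.
  by move: g0 g2 g3; move: #|porbits g| => k; lia.
by apply: factor_sum_parity; rewrite g1 card_ord addn1 /=; case: odd.
Qed.

Lemma transitive_sum_pair_sum u c n (n0 : (0 < n)%N) :
  transitive_sum (fun j => c * u j) (fun=> c) [set: 'I_n] (Ordinal n0) =
  \sum_(k < n.+2) c ^+ k * pair_sum u 'I_n k.
Proof.
pose x0 := Ordinal n0.
have W (v : nat -> F) (s : 'S_n) : \prod_(d in porbits s) (c * v #|d|) =
    c ^+ #|porbits s| * \prod_(d in porbits s) v #|d|.
  by rewrite big_split /= prodr_const.
have on (s : 'S_n) : perm_on [set: 'I_n] s by apply/subsetP => y; rewrite inE.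
rewrite /transitive_sum (eq_bigl xpredT) //.
under [RHS]eq_bigr => k _ do rewrite /pair_sum mulr_sumr.
rewrite exchange_big /=; apply: eq_bigr => s _.
under [RHS]eq_bigr => k _ do rewrite mulr_sumr.
rewrite (exchange_big_dep (fun t => joint_orbit s t x0 == [set: 'I_n])) /=; last first.
  by move=> k t _ /andP[trans _]; rewrite -jointly_transitiveP.
apply: eq_big => [t|t /andP[_ trans]]; first by rewrite on.
rewrite !cycle_weightT W.
rewrite prodr_const mulrAC -exprD.
have := genus_bound_transitive (eqP trans); have := porbits_gt0 (s * t)%g x0.
rewrite card_ord => p0 bound.
have lt : (#|porbits s| + #|porbits t| < n.+2)%N.
  by move: p0 bound; move: #|porbits s| #|porbits t| #|porbits (s * t)| => i j k; lia.
rewrite (big_pred1 (Ordinal lt)) // => k.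
by rewrite (jointly_transitiveP _ _ x0) trans /= eq_sym.
Qed.

(** The variable [u n] only occurs for [n]-cycles, where it is the whole weight. *)
Lemma perm_weight_split u n (s : 'S_n) : (0 < n)%N ->
  perm_weight u s = perm_weight (fun j => if (j < n)%N then u j else 0) s
                    + u n * perm_weight (fun j => (j == n)%:R) s.
Proof.
move=> n0; rewrite /perm_weight.
have [|nfull] := boolP [exists C in porbits s, #|C| == n].
  case/exists_inP => C CP /eqP Cn.
  have CT : C = [set: 'I_n].
    by apply/eqP; rewrite eqEcard subsetT cardsT card_ord Cn leqnn.
  suff -> : porbits s = [set C].
    by rewrite !big_set1 Cn ltnn eqxx mulr1 add0r.
  apply/setP => D; rewrite inE; apply/idP/eqP => [|-> //].
  case/imsetP => x _ ->; apply/esym/porbit_of_block => //; by rewrite CT inE.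
have lt C : C \in porbits s -> (#|C| < n)%N.
  move=> CP; rewrite ltn_neqAle -[X in (_ <= X)%N](card_ord n) max_card andbT.
  by apply: contra nfull => Cn; apply/exists_inP; exists C.
have CP : porbit s (Ordinal n0) \in porbits s by apply: imset_f.
rewrite [X in _ + _ * X](bigD1 _ CP) /= (ltn_eqF (lt _ CP)) mul0r mulr0 addr0.
by apply: eq_bigr => C /lt ->.
Qed.

Lemma pair_sum_split u n k : (0 < n)%N ->
  pair_sum u 'I_n k = pair_sum (fun j => if (j < n)%N then u j else 0) 'I_n k
                    + u n * pair_sum (fun j => (j == n)%:R) 'I_n k.
Proof.
move=> n0; rewrite /pair_sum mulr_sumr -big_split; apply: eq_bigr => s _ /=.
by rewrite mulr_sumr -big_split; apply: eq_bigr => t _ /=; exact: perm_weight_split.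
Qed.

End PairSumOrdinal.

Section NoncrossingSums.
Variable R : comPzRingType.
Implicit Types (u v : nat -> R).

Lemma NC_block_size n (P : {set {set 'I_n}}) V : P \in NC n -> V \in P ->
  (0 < #|V| <= n)%N.
Proof.
rewrite !inE => /andP[partP _] VP; rewrite card_gt0 (partition_neq0 partP VP) /=.
by rewrite -[X in (_ <= X)%N](card_ord n) max_card.
Qed.

(** This makes the relation between moments and cumulants triangular. *)
Lemma NC_block_lt n (P : {set {set 'I_n.+1}}) V : P \in NC n.+1 ->
  P != [set [set: 'I_n.+1]] -> V \in P -> (0 < #|V| <= n)%N.
Proof.
move=> PNC Ptop VP; have /andP[-> Vn] := NC_block_size PNC VP.
move: Vn; rewrite leq_eqVlt => /orP[/eqP Vn|//]; case/eqP: Ptop.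
have VT : V = [set: 'I_n.+1].
  by apply/eqP; rewrite eqEcard subsetT cardsT card_ord Vn leqnn.
move: PNC; rewrite !inE => /andP[partP _].
apply/setP => W; rewrite inE -VT; apply/idP/eqP => [WP|-> //].
have /set0Pn[x xW] := partition_neq0 partP WP.
have xV : x \in V by rewrite VT inE.
rewrite -(def_pblock (partition_trivIset partP) WP xW).
exact: def_pblock (partition_trivIset partP) VP xV.
Qed.

Lemma sum_NC_top u n :
  \sum_(P in NC n.+1) mult_ext u P =
  u n.+1 + \sum_(P in NC n.+1 | P != [set [set: 'I_n.+1]]) mult_ext u P.
Proof.
rewrite (bigD1 _ (top_NC n)) /=; congr (_ + _).
by rewrite /mult_ext big_set1 cardsT card_ord.
Qed.

(** The block-by-block derivation of the sums over noncrossing partitions is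
    triangular, with [1] on the diagonal. *)
Lemma sum_NC_derivation_inj u v (r : nat -> R) :
  (forall n, (0 < n)%N -> \sum_(P in NC n) \sum_(V in P) u #|V| * mult_ext r (P :\ V) =
                     \sum_(P in NC n) \sum_(V in P) v #|V| * mult_ext r (P :\ V)) ->
  forall n, (0 < n)%N -> u n = v n.
Proof.
move=> h n; elim/ltn_ind: n => -[//|n] ih _.
have top w : \sum_(V in [set [set: 'I_n.+1]]) w #|V| * mult_ext r ([set [set: 'I_n.+1]] :\ V)
    = w n.+1.
  by rewrite big_set1 setDv /mult_ext big_set0 mulr1 cardsT card_ord.
have := h n.+1 isT; rewrite !(bigD1 _ (top_NC n)) /= !top.
rewrite (eq_bigr (fun P : {set {set 'I_n.+1}} => \sum_(V in P) v #|V| * mult_ext r (P :\ V))); first exact: addIr.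
move=> P /andP[PNC Ptop]; apply: eq_bigr => V VP.
by case/andP: (NC_block_lt PNC Ptop VP) => V0 Vn; rewrite ih.
Qed.

Lemma sum_NC_top_indicator n : (0 < n)%N ->
  \sum_(P in NC n) mult_ext (fun j => (j == n)%:R) P = 1 :> R.
Proof.
case: n => // n _; rewrite sum_NC_top eqxx big1 ?addr0 // => P /andP[PNC Ptop].
have partP : partition P [set: 'I_n.+1] by move: PNC; rewrite !inE => /andP[].
have VP : pblock P ord0 \in P by rewrite pblock_mem // (cover_partition partP) inE.
rewrite /mult_ext (bigD1 _ VP) /=.
have /andP[_ Vn] := NC_block_lt PNC Ptop VP.
by rewrite (ltn_eqF (_ : #|pblock P ord0| < n.+1)%N) ?mul0r.
Qed.

End NoncrossingSums.

(* Imported only now, because these set notations shadow those of [finset]. *)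
From mathcomp Require Import all_classical all_reals all_analysis.

Import numFieldNormedType.Exports.

Local Open Scope classical_set_scope.
Local Open Scope ring_scope.

(** * The genus expansion of the moments of a polynomial *)

Section RealRooted.
Variable R : realType.

Lemma real_rooted_factorization d (p : {poly R}) : real_rooted_poly d p ->
  exists2 s : seq R, size s = d & p = \prod_(z <- s) ('X - z%:P).
Proof.
case=> p_monic p_size p_real.
have [r pr] := closed_field_poly_normal (map_poly (real_complex R) p).
have lc : lead_coef (map_poly (real_complex R) p) = 1.
  by rewrite lead_coef_map (monicP p_monic) rmorph1.
rewrite lc scale1r in pr.
have r_real z : z \in r -> exists x : R, z = real_complex R x.
  by move=> zr; apply: p_real; rewrite pr root_prod_XsubC.
have [s rs] : exists s : seq R, r = map (real_complex R) s.
  elim: (r) r_real => [|z r' ih] r_real; first by exists [::].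
  have [x ->] := r_real z (mem_head _ _).
  have [s ->] := ih (fun y yr => r_real y (mem_behead (s := z :: r') yr)).
  by exists (x :: s).
have ps : p = \prod_(z <- s) ('X - z%:P).
  apply: (map_inj_poly (@complexI R)); rewrite ?rmorph0 //.
  rewrite pr rs big_map rmorph_prod; apply: eq_bigr => z _.
  by rewrite /= rmorphB /= map_polyX map_polyC.
exists s => //; apply: succn_inj; rewrite -p_size ps size_prod_XsubC.
by [].
Qed.

(** From distinct roots with multiplicities to a list of roots. *)
Lemma poly_moment_roots d (s : seq R) n :
  poly_moment d (\prod_(z <- s) ('X - z%:P)) n = d%:R^-1 * \sum_(z <- s) z ^+ n.
Proof.
rewrite /poly_moment; congr (_ * _).
have -> : [set x : R | root (\prod_(z <- s) ('X - z%:P)) x] = [set` undup s].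
  by apply/seteqP; split=> x /=; rewrite root_prod_XsubC mem_undup.
rewrite -fsbig_seq ?undup_uniq //.
rewrite -(@big_undup_iterop_count _ _ +%R _ s xpredT (fun z => z ^+ n)).
apply: eq_bigr => z _; rewrite mu_prod_XsubC mulr_natl.
by [].
Qed.
End RealRooted.

Section GenusExpansion.
Variable R : realType.

Lemma finite_free_cumulantE d (p : {poly R}) n : finite_free_cumulant d p n =
  (- d%:R) ^+ n.-1 / n.-1`!%:R * partition_sum (@log_coef R) (poly_e d p) [set: 'I_n]%SET.
Proof.
by congr (_ * _); apply: eq_bigl => P; rewrite inE.
Qed.

(** [moment_cumulant_rec] turned into the recursion of [perm_sum_exp_rec]: the factor
    [(n - 1)!] in the finite free cumulants compensates for the number of cyclic
    permutations of a block. *)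
Lemma perm_sum_cumulant d (p : {poly R}) (T : finType) (S : {set T}) :
  poly_e d p 0 = 1 ->
  perm_sum (fun j => - d%:R * finite_free_cumulant d p j) S =
  (- d%:R) ^+ #|S| * poly_e d p #|S|.
Proof.
move=> e0; set e := poly_e d p in e0 *; pose D : R := - d%:R.
pose alpha k := D ^+ k * e k / k`!%:R.
have fact_neq0 k : k`!%:R != 0 :> R by rewrite pnatr_eq0 -lt0n fact_gt0.
rewrite (@perm_sum_exp_rec _ _ _ alpha).
- by rewrite /alpha mulrC divfK.
- by rewrite /alpha expr0 e0 mul1r divff.
case=> // k _; rewrite /exp_rec.
have := moment_cumulant_rec e0 (finset.in_setT (ord0 : 'I_k.+1)).
under eq_bigr do rewrite partition_sum_card.
rewrite (sum_subset_card_pointed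
  (fun i j => partition_sum (@log_coef R) e [set: 'I_i]%SET * e j) (finset.in_setT ord0)).
rewrite cardsT card_ord /= => rec.
have k0 : k.+1%:R != 0 :> R by rewrite pnatr_eq0.
transitivity (D ^+ k.+1 / k`!%:R * e k.+1).
  rewrite /alpha factS natrM; move: (k.+1%:R) k0 => c c0; field.
  by rewrite fact_neq0 c0.
rewrite -rec mulr_sumr; apply: eq_bigr => j _.
have jk : (j <= k)%N by rewrite -ltnS.
rewrite subSS finite_free_cumulantE /= -/D -/e /alpha.
have bin_neq0 : 'C(k, j)%:R != 0 :> R by rewrite pnatr_eq0 -lt0n bin_gt0.
have -> : k`!%:R = 'C(k, j)%:R * (j`!%:R * (k - j)`!%:R) :> R.
  by rewrite -!natrM bin_fact.
have -> : D ^+ k.+1 = D * D ^+ j * D ^+ (k - j) by rewrite -exprS -exprD addSn subnKC.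
rewrite -[_ *+ 'C(k, j)]mulr_natr.
move: (partition_sum _ _ _) => c; field.
by rewrite !fact_neq0 bin_neq0.
Qed.

(** Apply [transitive_sum_of_perm_sum] with weight [- d * kappa] for the first
    permutation and [- d] for the second; the hypothesis on the sums over all
    pairs is given by [perm_sum_cumulant] and [perm_sum_const], and the recursion
    by Newton's identities. *)
Lemma genus_expansion d (p : {poly R}) n : real_rooted_poly d p -> (0 < n <= d)%N ->
  poly_moment d p n = (n.-1`!%:R)^-1 *
    \sum_(k < n.+2) (- d%:R^-1) ^+ (n.+1 - k) * pair_sum (finite_free_cumulant d p) 'I_n k.
Proof.
move=> p_rr /andP[n0 nd]; have [s sd ps] := real_rooted_factorization p_rr.
have d0 : d%:R != 0 :> R by rewrite pnatr_eq0 -lt0n (leq_trans n0).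
have lead : p`_d = 1.
  by case: p_rr => /monicP + pd _; rewrite /lead_coef pd.
have e0 : poly_e d p 0 = 1 by rewrite /poly_e subn0 lead bin0 expr0 !mul1r invr1.
pose D : R := - d%:R; have D0 : D != 0 by rewrite oppr_eq0.
pose P j := \sum_(z <- s) z ^+ j.
have fact_neq0 k : k`!%:R != 0 :> R by rewrite pnatr_eq0 -lt0n fact_gt0.
have := @transitive_sum_of_perm_sum _ 'I_n (fun j => D * finite_free_cumulant d p j)
  (fun=> D) (fun k => D ^+ k * p`_(d - k)) (fun j => D ^+ j * - P j) d.
move/(_ _ _ _ [set: 'I_n]%SET (Ordinal n0)); rewrite cardsT card_ord inE.
rewrite transitive_sum_pair_sum => /(_ _ _ _ isT nd) E.
have {}E : \sum_(k < n.+2) D ^+ k * pair_sum (finite_free_cumulant d p) 'I_n k =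
   n.-1`!%:R * (D ^+ n * - P n).
  apply: E.
  - by rewrite expr0 mul1r subn0.
  - move=> k /andP[_ kd]; rewrite /exp_rec.
    have := newton_prod_XsubC (s := s) (k := k); rewrite -ps sd => /(_ kd) /= newton.
    rewrite mulrCA newton mulr_sumr; apply: eq_bigr => j _.
    have -> : D ^+ k = D ^+ j.+1 * D ^+ (k - j.+1) by rewrite -exprD subnKC.
    by rewrite /P; ring.
  - move=> S Sd; rewrite perm_sum_cumulant // perm_sum_const /poly_e.
    rewrite -bin_ffact natrM.
    have bin_neq0 : 'C(d, #|S|)%:R != 0 :> R by rewrite pnatr_eq0 -lt0n bin_gt0.
    rewrite -/D; have : (-1) ^+ #|S| * (-1) ^+ #|S| = 1 :> R.
      by rewrite -expr2 sqrr_sign.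
    move: ((-1) ^+ #|S|) => sg sg2.
    transitivity ((sg * sg) * ((#|S|)`!%:R * (D ^+ #|S| * p`_(d - #|S|)))); last by rewrite sg2 mul1r.
    by field.
have -> : poly_moment d p n = d%:R^-1 * P n by rewrite [in LHS]ps poly_moment_roots.
have -> : P n = - (D ^- n) * (n.-1`!%:R^-1 *
    \sum_(k < n.+2) D ^+ k * pair_sum (finite_free_cumulant d p) 'I_n k).
  by rewrite E; field; rewrite fact_neq0 expf_neq0.
have step (k : 'I_n.+2) : (- d%:R^-1) ^+ (n.+1 - k) = D ^- n.+1 * D ^+ k.
  have -> : D ^+ n.+1 = D ^+ (n.+1 - k) * D ^+ k.
    by rewrite -exprD subnK // -ltnS.
  by rewrite -invrN -/D exprVn invfM divfK // expf_neq0.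
under [in RHS]eq_bigr => k _ do rewrite step -mulrA.
rewrite -mulr_sumr exprS invfM.
have -> : d%:R^-1 = - D^-1 by rewrite invrN opprK.
by ring.
Qed.

End GenusExpansion.

(** * Expansions to first order in 1/d *)

Section Jets.
Variable R : realType.
Implicit Types (x y : nat -> R) (a b c : R).

(** [x d = a + b / d + o(1 / d)], in a form to which the rules for limits apply. *)
Definition jet x a b := (fun d => d%:R * (x d - a)) @ \oo --> b.

Lemma near_inv_gt0 : \forall d \near \oo, (d%:R : R) != 0.
Proof. by exists 1%N => // d /=; rewrite pnatr_eq0 -lt0n. Qed.

Lemma cvg_near_eq (f g : nat -> R) (l : R) : (\forall d \near \oo, f d = g d) ->
  f @ \oo --> l -> g @ \oo --> l.
Proof. by move=> fg; apply: cvg_trans; exact: near_eq_cvg. Qed.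

Lemma jet_near x y a b : (\forall d \near \oo, x d = y d) -> jet x a b -> jet y a b.
Proof.
by move=> xy; apply: cvg_near_eq; apply: filterS xy => d ->.
Qed.

Lemma cvg_inv_nat : (fun d : nat => d%:R^-1 : R) @ \oo --> (0 : R).
Proof.
by rewrite -cvg_shiftS; exact: cvg_harmonic.
Qed.

Lemma jet_cvg x a b : jet x a b -> x @ \oo --> a.
Proof.
move=> xab.
have : (fun d => a + d%:R^-1 * (d%:R * (x d - a))) @ \oo --> a + 0 * b.
  by apply: cvgD; [exact: cvg_cst|apply: cvgM => //; exact: cvg_inv_nat].
rewrite mul0r addr0; apply: cvg_near_eq.
near=> d; rewrite mulKf ?subrKC //; near: d; exact: near_inv_gt0.
Unshelve. all: by end_near. Qed.

Lemma jet_cst a : jet (fun=> a) a 0.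
Proof. by rewrite /jet subrr; under eq_fun do rewrite mulr0; exact: cvg_cst. Qed.

Lemma jetD x y a b a' b' : jet x a b -> jet y a' b' -> jet (fun d => x d + y d) (a + a') (b + b').
Proof.
move=> xa ya; apply: (cvg_near_eq _ (cvgD xa ya)); apply: nearW => d /=.
by rewrite !fctE; ring.
Qed.

Lemma jetM x y a b a' b' : jet x a b -> jet y a' b' ->
  jet (fun d => x d * y d) (a * a') (b * a' + a * b').
Proof.
move=> xa ya; have xc := jet_cvg xa.
apply: (cvg_near_eq _ (cvgD (cvgM xa (cvg_cst a')) (cvgM xc ya))); apply: nearW => d /=.
by rewrite !fctE /=; ring.
Qed.

Lemma jet_unique x a b a' b' : jet x a b -> jet x a' b' -> a = a' /\ b = b'.
Proof.
move=> h h'; have uniq (f : nat -> R) (l l' : R) : f @ \oo --> l -> f @ \oo --> l' -> l = l'.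
  by move=> fl fl'; rewrite -(cvg_lim (@Rhausdorff R) fl) -(cvg_lim (@Rhausdorff R) fl').
have aa' := uniq _ _ _ (jet_cvg h) (jet_cvg h').
by split=> //; rewrite -aa' in h'; exact: uniq h h'.
Qed.

Lemma jetV x a b : a != 0 -> jet x a b -> jet (fun d => (x d)^-1) a^-1 (- b / a ^+ 2).
Proof.
move=> a0 xab; have xc := jet_cvg xab.
have xn0 : \forall d \near \oo, x d != 0 by exact: cvgr_neq0 xc a0.
have : (fun d => - (d%:R * (x d - a)) * ((x d)^-1 / a)) @ \oo --> - b * (a^-1 / a).
  by apply: cvgM; [exact: cvgN|apply: cvgM (cvg_cst _); exact: cvgV].
rewrite -invfM -expr2; apply: cvg_near_eq.
apply: filterS xn0 => d xd0 /=; field.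
by rewrite a0 xd0.
Qed.

Lemma jet_inv_nat : jet (fun d => d%:R^-1) 0 1.
Proof.
apply: (cvg_near_eq _ (cvg_cst (1 : R))); apply: filterS near_inv_gt0 => d d0 /=.
by rewrite subr0 mulfV.
Qed.

Lemma jet_sum (I : Type) (r : seq I) (P : pred I) (x : I -> nat -> R) (a b : I -> R) :
  (forall i, P i -> jet (x i) (a i) (b i)) ->
  jet (fun d => \sum_(i <- r | P i) x i d) (\sum_(i <- r | P i) a i) (\sum_(i <- r | P i) b i).
Proof.
move=> h; elim: r => [|i r ih].
  by rewrite !big_nil; under eq_fun do rewrite big_nil; exact: jet_cst.
rewrite !big_cons; under eq_fun do rewrite big_cons.
by case: ifP => // Pi; apply: jetD ih; exact: h.
Qed.

Lemma jet_prod_set (I : finType) (A : {set I}) (x : I -> nat -> R) (a b : I -> R) :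
  (forall i, i \in A -> jet (x i) (a i) (b i)) ->
  jet (fun d => \prod_(i in A) x i d) (\prod_(i in A) a i)
      (\sum_(i in A) b i * \prod_(j in (A :\ i)%SET) a j).
Proof.
elim/ltn_ind: {A}#|A| {-2}A (erefl #|A|) => k ih A Ak h.
have [->|[i iA]] := set_0Vmem A.
  by rewrite !big_set0; under eq_fun do rewrite big_set0; exact: jet_cst.
have lt : (#|A :\ i| < k)%N by rewrite -Ak [X in (_ < X)%N](cardsD1 i) iA.
have jA := ih _ lt (A :\ i)%SET erefl
  (fun j (jA : j \in (A :\ i)%SET) => h j (fintype.subsetP (finset.subD1set A i) j jA)).
have E j : j \in (A :\ i)%SET -> a i * (b j * \prod_(l in (A :\ i :\ j)%SET) a l) =
    b j * \prod_(l in (A :\ j)%SET) a l.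
  rewrite finset.in_setD1 => /andP[ji jA'].
  rewrite mulrCA (big_setD1 i (A := (A :\ j)%SET)) /=.
    by congr (_ * (_ * _)); apply: eq_bigl => l; rewrite !finset.in_setD1 andbCA.
  by rewrite finset.in_setD1 eq_sym ji iA.
have := jetM (h i iA) jA; rewrite mulr_sumr (eq_bigr _ E).
rewrite -(big_setD1 i iA) -(big_setD1 i iA (F := fun j => b j * \prod_(l in (A :\ j)%SET) a l)).
by apply: jet_near; apply: nearW => d; rewrite -(big_setD1 i iA).
Qed.

Lemma jet_littleo x a b :
  ((fun d => x d : R^o) = (fun d => a + d%:R^-1 * b : R^o) +o_\oo (fun d => d%:R^-1 : R^o))
  <-> jet x a b.
Proof.
split=> [/eqaddoP h|h].
  apply/cvgrPdist_le => e e0; near=> d.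
  have d0 : (d%:R : R) != 0 by near: d; exact: near_inv_gt0.
  have : `|x d - (a + d%:R^-1 * b)| <= e * `|d%:R^-1| by near: d; exact: h.
  rewrite normfV ler_pdivlMr ?normr_gt0 // -normrM distrC.
  by congr (`|_| <= _); field.
apply/eqaddoP => e e0; move/cvgrPdist_le: h => /(_ e e0) h; near=> d.
have d0 : (d%:R : R) != 0 by near: d; exact: near_inv_gt0.
have : `|b - d%:R * (x d - a)| <= e by near: d; exact: h.
rewrite -[(_ - _) d]/(x d - (a + d%:R^-1 * b)).
rewrite normfV ler_pdivlMr ?normr_gt0 // -normrM distrC.
by congr (is_true (`|_| <= _)); field.
Unshelve. all: by end_near. Qed.

End Jets.

(** * Infinitesimal moments and cumulants *)

Section GenusMoment.
Variable R : realType.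
Implicit Types (u a b : nat -> R) (w : nat -> nat -> R).

(** The right-hand side of [genus_expansion], with [h] in place of [1 / d] and
    arbitrary cumulants. *)
Definition genus_moment (n : nat) (h : R) u : R := (n.-1`!%:R)^-1 *
  \sum_(k < n.+2) (- h) ^+ (n.+1 - k) * pair_sum u 'I_n k.

Definition annular_sum n u : R := n%:R / 2%:R *
  \sum_(1 <= t < n) \sum_(s in S_NC t (n - t)) mult_ext_perm u s / (t * (n - t))%:R.

Lemma fact_neq0 n : n`!%:R != 0 :> R.
Proof. by rewrite pnatr_eq0 -lt0n fact_gt0. Qed.

Lemma fact_pred n : (0 < n)%N -> n`!%:R = n%:R * n.-1`!%:R :> R.
Proof. by case: n => // n _; rewrite factS natrM. Qed.

Lemma genus_momentE n h u : (0 < n)%N -> genus_moment n h u =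
  \sum_(P in NC n) mult_ext u P - h * annular_sum n u +
  h ^+ 2 * ((n.-1`!%:R)^-1 * \sum_(k < n) (- h) ^+ (n.-1 - k) * pair_sum u 'I_n k).
Proof.
move=> n0; rewrite /genus_moment 2!big_ord_recr /= subnn subSnn expr0 expr1 mul1r.
rewrite pair_sum_genus0 // pair_sum_annular // -/(annular_sum n u).
rewrite (eq_bigr (fun k : 'I_n => h ^+ 2 * ((- h) ^+ (n.-1 - k) * pair_sum u 'I_n k))).
  rewrite -mulr_sumr /annular_sum (fact_pred n0).
  have n0' : n.-1`!%:R != 0 :> R := fact_neq0 _.
  by field.
move=> k _; rewrite mulrA -[in RHS](sqrrN h) -exprD; congr (_ ^+ _ * _).
rewrite add2n; case: (n) n0 k => // m _ k /=.
have km : (k <= m)%N by rewrite -ltnS.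
by rewrite !subSn // leqW.
Qed.

Lemma jet_mult_ext n w a b (P : {set {set 'I_n}}) : P \in NC n ->
  (forall j, (0 < j)%N -> jet (fun d => w d j) (a j) (b j)) ->
  jet (fun d => mult_ext (w d) P) (mult_ext a P)
      (\sum_(V in P) b #|V| * mult_ext a (P :\ V)%SET).
Proof.
move=> PNC h.
apply: (@jet_prod_set R _ P (fun V d => w d #|V|) (fun V => a #|V|) (fun V => b #|V|)) => V VP.
by apply: h; case/andP: (NC_block_size PNC VP).
Qed.

Lemma jet_pair_sum n k w a b :
  (forall j, (0 < j)%N -> jet (fun d => w d j) (a j) (b j)) ->
  exists c, jet (fun d => pair_sum (w d) 'I_n k) (pair_sum a 'I_n k) c.
Proof.
move=> h; pose c (s : 'S_n) := \sum_(V in porbits s)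
  b #|V| * \prod_(W in (porbits s :\ V)%SET) a #|W|.
exists (\sum_s \sum_(t | jointly_transitive s t && (#|porbits s| + #|porbits t| == k)%N) c s).
apply: jet_sum => s _; apply: jet_sum => t _.
apply: (@jet_prod_set R _ (porbits s) (fun V d => w d #|V|)
  (fun V => a #|V|) (fun V => b #|V|)) => V /imsetP[x _ ->].
by apply: h; rewrite lt0n card_porbit_neq0.
Qed.

Lemma jetN (x : nat -> R) (a b : R) : jet x a b -> jet (fun d => - x d) (- a) (- b).
Proof.
move=> h; have := jetM (jet_cst (- 1)) h.
rewrite mul0r add0r !mulN1r; apply: jet_near; apply: nearW => d.
by rewrite mulN1r.
Qed.

Lemma jetX (x : nat -> R) (a b : R) k : jet x a b -> exists c, jet (fun d => x d ^+ k) (a ^+ k) c.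
Proof.
move=> h; elim: k => [|k [c ih]]; first by exists 0; exact: jet_cst.
eexists; rewrite exprS; have := jetM h ih; apply: jet_near; apply: nearW => d.
by rewrite exprS.
Qed.

(** Only the first two terms of [genus_momentE] matter at first order: the
    noncrossing one is differentiated block by block, the annular one already
    carries a factor [1 / d]. *)
Lemma jet_genus_moment n w a b : (0 < n)%N ->
  (forall j, (0 < j)%N -> jet (fun d => w d j) (a j) (b j)) ->
  jet (fun d => genus_moment n d%:R^-1 (w d)) (\sum_(P in NC n) mult_ext a P)
    (\sum_(P in NC n) \sum_(V in P) b #|V| * mult_ext a (P :\ V)%SET - annular_sum n a).
Proof.
move=> n0 h.
have jNC : jet (fun d => \sum_(P in NC n) mult_ext (w d) P) (\sum_(P in NC n) mult_ext a P)
    (\sum_(P in NC n) \sum_(V in P) b #|V| * mult_ext a (P :\ V)%SET).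
  by apply: jet_sum => P PNC; exact: jet_mult_ext.
have [c jA] : exists c, jet (fun d => annular_sum n (w d)) (annular_sum n a) c.
  have [c jP] := jet_pair_sum n n h.
  have E u : annular_sum n u = (n.-1`!%:R)^-1 * pair_sum u 'I_n n.
    rewrite pair_sum_annular // /annular_sum (fact_pred n0).
    by have := fact_neq0 n.-1; move=> ?; field.
  have := jetM (jet_cst (n.-1`!%:R)^-1) jP; rewrite -E => jP'.
  by eexists; apply: jet_near jP'; apply: nearW => d; rewrite E.
have [q0 [q1 jQ]] : exists q0 q1, jet (fun d => (n.-1`!%:R)^-1 *
     \sum_(k < n) (- d%:R^-1) ^+ (n.-1 - k) * pair_sum (w d) 'I_n k) q0 q1.
  have /choice[q jq] : forall k : 'I_n, exists q : (R * R)%type,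
      jet (fun d => (- d%:R^-1) ^+ (n.-1 - k) * pair_sum (w d) 'I_n k) q.1 q.2.
    move=> k; have [c1 j1] := jetX (n.-1 - k) (jetN (@jet_inv_nat R)).
    have [c2 j2] := jet_pair_sum n k h.
    by have j := jetM j1 j2; eexists (_, _); exact: j.
  eexists; eexists; apply: jetM (jet_cst _) _.
  exact: (@jet_sum R _ (index_enum _) xpredT _ _ _ (fun k _ => jq k)).
have jh := @jet_inv_nat R.
have := jetD (jetD jNC (jetN (jetM jh jA))) (jetM (jetM jh jh) jQ).
rewrite !(mul0r, mulr0, mul1r, addr0, add0r, oppr0).
apply: jet_near; apply: nearW => d.
by rewrite genus_momentE // expr2.
Qed.

(** The moment of order [n] is affine in the [n]-th cumulant. *)
Lemma genus_moment_split n h u : (0 < n)%N ->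
  genus_moment n h u = genus_moment n h (fun j => if (j < n)%N then u j else 0)
    + u n * genus_moment n h (fun j => (j == n)%:R).
Proof.
move=> n0; rewrite /genus_moment mulrCA -mulrDr; congr (_ * _).
rewrite mulr_sumr -big_split; apply: eq_bigr => k _ /=.
by rewrite pair_sum_split // mulrDr; congr (_ + _); rewrite mulrCA.
Qed.

End GenusMoment.

Section Limit.
Variables (R : realType) (p : nat -> {poly R}) (mu : probability (measurableTypeR R) R).
Hypothesis p_real_rooted : forall d : nat, (0 < d)%N -> real_rooted_poly d (p d).

Let kappa d := finite_free_cumulant d (p d).
Let r := free_cumulant mu.

Let near_genus n : (0 < n)%N ->
  \forall d \near \oo, genus_moment n d%:R^-1 (kappa d) = poly_moment d (p d) n.
Proof.
move=> n0; exists n => // d /= nd.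
by rewrite (genus_expansion (p_real_rooted (leq_trans n0 nd))) // n0.
Qed.

Lemma infinitesimal_momentsP m' : infinitesimal_moments p mu m' <->
  forall n, (0 < n)%N -> jet (fun d => poly_moment d (p d) n) (moment mu n) (m' n).
Proof. by split=> h n n0; apply/jet_littleo; exact: h. Qed.

Lemma infinitesimal_cumulantsP r' : infinitesimal_cumulants p mu r' <->
  forall n, (0 < n)%N -> jet (fun d => kappa d n) (r n) (r' n).
Proof. by split=> h n n0; apply/jet_littleo; exact: h. Qed.

Lemma infinitesimal_moments_of_cumulants r' m' : infinitesimal_cumulants p mu r' ->
  infinitesimal_relation mu m' r' -> infinitesimal_moments p mu m'.
Proof.
move=> /infinitesimal_cumulantsP kr rel; apply/infinitesimal_momentsP => n n0.
rewrite rel // (free_cumulant_seqP (moment mu) n0).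
exact: jet_near (near_genus n0) (jet_genus_moment n0 kr).
Qed.

(** Induction on [n]: the moment of order [n] is a function of the earlier
    cumulants plus [kappa_n] times a coefficient tending to [1], so the expansion
    of [kappa_n] is obtained by a division.  Its limit is the free cumulant because
    of the triangularity of the free moment-cumulant relation. *)
Lemma infinitesimal_cumulants_of_moments m' : infinitesimal_moments p mu m' ->
  exists r', infinitesimal_cumulants p mu r'.
Proof.
move=> /infinitesimal_momentsP mm.
suff /choice[r' kr] : forall n, exists b, (0 < n)%N -> jet (fun d => kappa d n) (r n) b.
  by exists r'; apply/infinitesimal_cumulantsP.
elim/ltn_ind => -[|n] ih; first by exists 0.
(* [genus_moment_split] at the cumulants: the first part ignores [kappa_(n + 1)],
   the second one is its coefficient. *)
pose trunc (u : nat -> R) j := if (j < n.+1)%N then u j else 0.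
have /choice[b jb] : forall j, exists b, (0 < j)%N -> jet (fun d => trunc (kappa d) j) (trunc r j) b.
  move=> j; rewrite /trunc; case: ifP => jn; last by exists 0 => _; exact: jet_cst.
  exact: ih.
have jT := jet_genus_moment (ltn0Sn n) jb.
pose delta j : R := (j == n.+1)%:R.
have jA := jet_genus_moment (w := fun=> delta) (b := fun=> 0) (ltn0Sn n)
  (fun j _ => jet_cst (delta j)).
rewrite (sum_NC_top_indicator R (ltn0Sn n)) in jA.
have jV := jetV (oner_neq0 R) jA.
have jk := jetM (jetD (mm n.+1 isT) (jetN jT)) jV.
have rE : moment mu n.+1 - \sum_(P in NC n.+1) mult_ext (trunc r) P = r n.+1.
  rewrite (free_cumulant_seqP (moment mu) (ltn0Sn n)) !sum_NC_top /trunc ltnn add0r.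
  rewrite -addrA [X in _ + X](_ : _ = 0) ?addr0 //.
  apply/eqP; rewrite subr_eq0; apply/eqP; apply: eq_bigr => P /andP[PNC Ptop].
  apply: eq_bigr => V VP; have /andP[_ Vn] := NC_block_lt PNC Ptop VP.
  by rewrite ltnS Vn.
rewrite rE invr1 mulr1 in jk.
eexists => _; apply: jet_near jk.
have A0 : \forall d \near \oo, genus_moment n.+1 d%:R^-1 delta != 0.
  exact: cvgr_neq0 (jet_cvg jA) (oner_neq0 R).
apply: filterS2 (near_genus (ltn0Sn n)) A0 => d <- A0.
by rewrite (genus_moment_split _ _ (ltn0Sn n)) addrAC subrr add0r mulfK.
Qed.

Lemma infinitesimal_relation_moments m' r' :
  infinitesimal_moments p mu m' -> infinitesimal_cumulants p mu r' ->
  infinitesimal_relation mu m' r'.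
Proof.
move=> /infinitesimal_momentsP mm /infinitesimal_cumulantsP kr n n0.
have := jet_near (near_genus n0) (jet_genus_moment n0 kr).
by case/(jet_unique (mm n n0)).
Qed.

Lemma infinitesimal_relation_inj m' r1 r2 :
  infinitesimal_relation mu m' r1 -> infinitesimal_relation mu m' r2 ->
  forall n, (0 < n)%N -> r1 n = r2 n.
Proof.
move=> rel1 rel2; apply: (@sum_NC_derivation_inj _ _ _ (free_cumulant mu)) => n n0.
by have := rel1 n n0; rewrite (rel2 n n0) => /addIr.
Qed.

End Limit.

Theorem lemma3p1 (R : realType) (p : nat -> {poly R})
    (mu : probability (measurableTypeR R) R)
    (p_real_rooted : forall d : nat, (0 < d)%N -> real_rooted_poly d (p d))
    (p_mu : limiting_distribution p mu) :
  [/\ (exists m' : nat -> R, infinitesimal_moments p mu m') <->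
      (exists r' : nat -> R, infinitesimal_cumulants p mu r'),
      (forall m' r' : nat -> R, infinitesimal_moments p mu m' ->
         (infinitesimal_cumulants p mu r' <-> infinitesimal_relation mu m' r')) &
      (forall m' r' : nat -> R, infinitesimal_cumulants p mu r' ->
         (infinitesimal_moments p mu m' <-> infinitesimal_relation mu m' r'))].
Proof.
split.
- split=> [[m' mm]|[r' kr]].
    exact: (infinitesimal_cumulants_of_moments p_real_rooted mm).
  exists (fun n => \sum_(P in NC n) \sum_(V in P)
      r' #|V| * mult_ext (free_cumulant mu) (P :\ V)%SET
    - annular_sum n (free_cumulant mu)).
  exact: (infinitesimal_moments_of_cumulants p_real_rooted kr).
- move=> m' r' mm; split=> [kr|rel].
    exact: (infinitesimal_relation_moments p_real_rooted mm kr).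
  have [r1 kr1] := infinitesimal_cumulants_of_moments p_real_rooted mm.
  have rel1 := infinitesimal_relation_moments p_real_rooted mm kr1.
  move=> n n0; rewrite -(infinitesimal_relation_inj rel1 rel n0).
  exact: kr1.
- move=> m' r' kr; split=> [mm|rel].
    exact: (infinitesimal_relation_moments p_real_rooted mm kr).
  exact: (infinitesimal_moments_of_cumulants p_real_rooted kr rel).
Qed.
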